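(* Consider the linear system with additive noise $$dx(t)=[Ax(t)+B_1u(t)]\,dt+B_2\,dM(t),\quad x(0)=0,\qquad y(t)=Cx(t),\quad t\ge0,$$ and the reduced system consisting of two subsystems $$\begin{aligned} d\hat x_1(t)&=[\hat A_1\hat x_1(t)+\hat B_1u(t)]\,dt,\quad \hat x_1(0)=0,\\ d\hat x_2(t)&=\hat A_2\hat x_2(t)\,dt+\hat B_2\,dM(t),\quad \hat x_2(0)=0,\\ \hat y(t)&=\hat C_1\hat x_1(t)+\hat C_2\hat x_2(t),\quad t\ge0, \end{aligned}$$ with the same control $u$ and noise $M$. Suppose that all eigenvalues of $A$, $\hat A_1$ and $\hat A_2$ have negative real part. Then, for every $T>0$, $$\sup_{t\in[0,T]}\mathbb E\left\|y(t)-\hat y(t)\right\|\le\left\|Ce^{A\cdot}B_1-\hat C_1e^{\hat A_1\cdot}\hat B_1\right\|_{\mathcal L^2(I)}\left\|u\right\|_{L^2_T}+\left\|Ce^{A\cdot}B_2-\hat C_2e^{\hat A_2\cdot}\hat B_2\right\|_{\mathcal L^2(K^{1/2})}.$$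
   Context: Matrices: $A\in\mathbb R^{n\times n}$, $B_1\in\mathbb R^{n\times m_1}$, $B_2\in\mathbb R^{n\times m_2}$, $C\in\mathbb R^{p\times n}$; for $i=1,2$: $\hat A_i\in\mathbb R^{r_i\times r_i}$, $\hat B_i\in\mathbb R^{r_i\times m_i}$, $\hat C_i\in\mathbb R^{p\times r_i}$. Noise: $(\Omega,\mathcal F,(\mathcal F_t)_{t\ge0},\mathbb P)$ is a filtered probability space with right-continuous and complete filtration. $M$ is an $\mathbb R^{m_2}$-valued square integrable Lévy process with mean zero, $(\mathcal F_t)$-adapted, with $M(t+h)-M(t)$ independent of $\mathcal F_t$ for $t,h\ge0$, and covariance matrix $K$, i.e. $\mathbb E[M(t)M^T(t)]=Kt$; $K^{1/2}$ is its symmetric positive semidefinite square root. Control: $u$ is an $\mathbb R^{m_1}$-valued $(\mathcal F_t)$-adapted process with $\|u\|_{L^2_T}^2:=\mathbb E\int_0^T\|u(s)\|^2ds<\infty$ for all $T>0$ ($\|\cdot\|$ the Euclidean norm). Norm: for a (deterministic) matrix-valued function $Y$ on $[0,\infty)$ and a square matrix $\mathcal W$ of matching size, $\|Y\|^2_{\mathcal L^2(\mathcal W)}:=\int_0^\infty\|Y(s)\mathcal W\|_F^2\,ds$, with $\|\cdot\|_F$ the Frobenius norm. $Ce^{A\cdot}B$ denotes the function $s\mapsto Ce^{As}B$. *)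

(* Defs.v *)
(* Built on MathComp, MathComp-Analysis and, for R[i], MathComp Real-Closed. *)
From mathcomp Require Import all_boot all_order all_algebra.
From mathcomp Require Import complex.
From mathcomp Require Import all_classical all_reals all_analysis.

Set Implicit Arguments.
Unset Strict Implicit.
Unset Printing Implicit Defensive.

Import Order.TTheory GRing.Theory Num.Theory.
Import numFieldNormedType.Exports.

Local Open Scope classical_set_scope.
Local Open Scope ring_scope.

(* The library's norm `|A| on matrices is the maximum norm, hence these
   definitions. *)
Definition frobenius (R : realType) m n (A : 'M[R]_(m, n)) : R :=
  Num.sqrt (\sum_i \sum_j A i j ^+ 2).

Definition enorm (R : realType) n (v : 'cV[R]_n) : R :=
  Num.sqrt (\sum_i v i 0 ^+ 2).

Definition expm (R : realType) n (A : 'M[R]_n) : 'M[R]_n :=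
  limn (series (fun k => (k`!%:R)^-1 *: A ^+ k)).

Definition stable (R : realType) n (A : 'M[R]_n) : Prop :=
  forall z : R[i],
    eigenvalue (map_mx (real_complex R) A) z -> complex.Re z < 0.

Definition psd_sqrt (R : realType) n (K S : 'M[R]_n) : Prop :=
  [/\ S^T = S,
      forall v : 'cV[R]_n, 0 <= (v^T *m S *m v) 0 0
    & S *m S = K].

Definition L2norm (R : realType) m n (Y : R -> 'M[R]_(m, n)) (W : 'M[R]_n) :
    \bar R :=
  sqrte (\int[lebesgue_measure]_(s in `[0%R, +oo[)
           (frobenius (Y s *m W) ^+ 2)%R%:E)%E.

(* 'cV[R]_n with its Borel sigma-algebra *)
Notation borel_cV R n := (g_sigma_algebraType (@open 'cV[R]_n)).

(* Processes are functions R -> Omega -> 'cV[R]_n of which only the values at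
   times t >= 0 matter; likewise for filtrations. *)

Record filtration_usual (d : measure_display) (Omega : measurableType d)
    (R : realType) (P : probability Omega R)
    (F : R -> set (set Omega)) : Prop := FiltrationUsual {
  filtration_sigma : forall t : R, 0 <= t -> sigma_algebra [set: Omega] (F t);
  filtration_measurable : forall t : R, 0 <= t -> F t `<=` measurable;
  filtration_homo : forall s t : R, 0 <= s -> s <= t -> F s `<=` F t;
  filtration_right_continuous : forall t : R, 0 <= t ->
    \bigcap_(s in [set s | t < s]) F s `<=` F t;
  (* As F 0 `<=` measurable, this also makes P complete. *)
  filtration_complete : forall A, P.-negligible A -> F 0 A }.

Definition adapted (d : measure_display) (Omega : measurableType d)
    (R : realType) n (F : R -> set (set Omega)) (X : R -> Omega -> 'cV[R]_n) :
    Prop :=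
  forall t : R, 0 <= t ->
    forall B : set (borel_cV R n), measurable B -> F t (X t @^-1` B).

Definition jointly_measurable (d : measure_display) (Omega : measurableType d)
    (R : realType) n (X : R -> Omega -> 'cV[R]_n) : Prop :=
  @measurable_fun _ _ (measurableTypeR R * Omega)%type (borel_cV R n)
    ([set t | 0 <= t] `*` [set: Omega]) (fun z => X z.1 z.2).

(* Paths need not be right-continuous with left limits; every Lévy process in
   that narrower sense is one in the sense below. *)
Record levy_process (d : measure_display) (Omega : measurableType d)
    (R : realType) (P : probability Omega R) n (M : R -> Omega -> 'cV[R]_n) :
    Prop := LevyProcess {
  levy_measurable : forall t : R, 0 <= t ->
    measurable_fun [set: Omega] (M t : Omega -> borel_cV R n);
  levy_start : {ae P, forall w, M 0 w = 0};
  levy_independent_increments : forall (k : nat) (t : nat -> R),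
    0 <= t 0%N -> nondecreasing_seq t ->
    forall B : 'I_k -> set (borel_cV R n), (forall i, measurable (B i)) ->
    P (\bigcap_i [set w | B i (M (t i.+1) w - M (t i) w)]) =
    (\prod_(i < k) P [set w | B i (M (t i.+1) w - M (t i) w)%R])%E;
  levy_stationary_increments : forall t h : R, 0 <= t -> 0 <= h ->
    forall B : set (borel_cV R n), measurable B ->
    P [set w | B (M (t + h) w - M t w)] = P [set w | B (M h w - M 0 w)];
  levy_continuous_in_probability : forall t e : R, 0 <= t -> 0 < e ->
    P [set w | e < enorm (M s w - M t w)]
      @[s --> within [set s | 0 <= s] (nbhs t)] --> 0%E }.

Definition square_integrable (d : measure_display) (Omega : measurableType d)
    (R : realType) (P : probability Omega R) n (M : R -> Omega -> 'cV[R]_n) :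
    Prop :=
  forall t : R, 0 <= t -> ('E_P[fun w => (enorm (M t w) ^+ 2)%R] < +oo)%E.

Definition mean_zero (d : measure_display) (Omega : measurableType d)
    (R : realType) (P : probability Omega R) n (M : R -> Omega -> 'cV[R]_n) :
    Prop :=
  forall t : R, 0 <= t -> forall i, ('E_P[fun w => M t w i 0%R] = 0)%E.

Definition covariance_matrix (d : measure_display) (Omega : measurableType d)
    (R : realType) (P : probability Omega R) n (M : R -> Omega -> 'cV[R]_n)
    (K : 'M[R]_n) : Prop :=
  forall t : R, 0 <= t -> forall i j,
    ('E_P[fun w => ((M t w *m (M t w)^T) i j)%R] = (K i j * t)%:E)%E.

Definition increments_independent_of_past (d : measure_display)
    (Omega : measurableType d) (R : realType) (P : probability Omega R) n
    (F : R -> set (set Omega)) (M : R -> Omega -> 'cV[R]_n) : Prop :=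
  forall t h : R, 0 <= t -> 0 <= h ->
    forall (A : set Omega) (B : set (borel_cV R n)), F t A -> measurable B ->
    P (A `&` [set w | B (M (t + h) w - M t w)]) =
    (P A * P [set w | B (M (t + h) w - M t w)%R])%E.

Definition control_norm (d : measure_display) (Omega : measurableType d)
    (R : realType) (P : probability Omega R) m (T : R)
    (u : R -> Omega -> 'cV[R]_m) : \bar R :=
  sqrte (\int[P]_w \int[lebesgue_measure]_(s in `[0%R, T])
           (enorm (u s w) ^+ 2)%R%:E)%E.

(* dx = [A x + B u] dt + G dM, x(0) = 0. The noise being additive, this is
   x(t) = \int_0^t (A x(s) + B u(s)) ds + G M(t) with a pathwise, entrywise
   Lebesgue integral. *)
Record solves_sde (d : measure_display) (Omega : measurableType d)
    (R : realType) (P : probability Omega R) (F : R -> set (set Omega))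
    n m k (A : 'M[R]_n) (B : 'M[R]_(n, m)) (G : 'M[R]_(n, k))
    (u : R -> Omega -> 'cV[R]_m) (M : R -> Omega -> 'cV[R]_k)
    (x : R -> Omega -> 'cV[R]_n) : Prop := SolvesSde {
  sde_adapted : adapted F x;
  sde_jointly_measurable : jointly_measurable x;
  sde_initial : {ae P, forall w, x 0 w = 0};
  sde_integrable : forall t : R, 0 <= t -> {ae P, forall w, forall i,
    lebesgue_measure.-integrable `[0, t]
      (fun s => ((A *m x s w + B *m u s w) i 0)%:E)};
  sde_equation : forall t : R, 0 <= t -> {ae P, forall w,
    x t w = (\col_i \int[lebesgue_measure]_(s in `[0, t])
                      (A *m x s w + B *m u s w) i 0)
            + G *m M t w} }.

(* Main.v *)
From HB Require Import structures.
Require Import Defs.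
From mathcomp Require Import all_boot all_order all_algebra.
From mathcomp Require Import complex.
From mathcomp Require Import all_classical all_reals all_analysis.
From mathcomp Require Import measurable_realfun.
From mathcomp Require Import ring lra.

Set Implicit Arguments.
Unset Strict Implicit.
Unset Printing Implicit Defensive.

Import Order.TTheory GRing.Theory Num.Theory.
Import numFieldNormedType.Exports.

Local Open Scope classical_set_scope.
Local Open Scope ring_scope.

(** Fix a time t > 0.  For each row c of the output matrix of a subsystem
    dx = [A x + B u] dt + G dM, variation of constants
    gives
      c x(t) = int_0^t c e^(A(t-s)) B u(s) ds + int_0^t c e^(A(t-s)) G dM(s),
    so that y - yh splits into a control part with kernel
    Hu(s) = C e^(As) B1 - Ch1 e^(Ah1 s) Bh1 and a noise part with kernel
    H(s) = C e^(As) B2 - Ch2 e^(Ah2 s) Bh2.  The Cauchy-Schwarz inequality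
    bounds the control part, the Ito isometry gives the second moment of the
    noise part, and enlarging [0, t] to [0, +oo[ and to [0, T] gives the claim.

    No stochastic integral is constructed.  Integrating by parts, the noise
    part is
      H(0) M(t) + int_0^t H'(t-s) M(s) ds,
    a time integral of a process that is linear in M.  At a fixed time G M(s)
    agrees almost surely with N(s) = x(s) - int_0^s (A x + B u), and N is jointly
    measurable in time and chance, which is not assumed of M.  With N in place of G M the
    variation of constants formula is a pathwise identity
    ([mild_output_sde]): it is an integration by parts of the primitive of an
    integrable function against a smooth one ([ibp_primitive]), hence an
    exchange of two integrals.

    For the Ito isometry, independence of the increments and the covariance of
    M give E[M(r) M(s)^T] = K min(r, s) ([noise_covariance]).  The second
    moment of a time integral is the double integral of the covariance
    ([second_moment_path_integral]), and for a covariance built from min(r, s)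
    that double integral is int_0^t |H(s) S|^2 ds with S^2 = K, by the
    fundamental theorem of calculus alone ([noise_kernel_integral],
    [noise_variance]).

    The Cauchy-Schwarz inequalities enter through
    a b <= l/2 a^2 + 1/(2 l) b^2, which is linear in the squares and can be
    integrated term by term before l > 0 is optimised ([norm_bound],
    [le_sqrt_of_amgm], [output_bound]). *)

(** * Entries of the matrix exponential *)

Lemma cvg_mx (R : realType) m n (u : nat -> 'M[R]_(m, n)) (l : 'M[R]_(m, n)) :
  (forall i j, (fun k => u k i j) @ \oo --> l i j) -> u @ \oo --> l.
Proof.
move=> H B [Q /= HQ sQ]; apply: filterS sQ _.
pose f (ij : 'I_m * 'I_n) := [set k : nat | Q ij.1 ij.2 (u k ij.1 ij.2)].
have : \forall k \near \oo, forall ij, f ij k.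
  by apply: filter_forall => -[i j]; exact: (H i j _ (HQ i j)).
by apply: filterS => k Hk i j; exact: (Hk (i, j)).
Qed.

(** The sum of the absolute values of all entries is submultiplicative, so the
    entries of the exponential series are dominated by a scalar exponential
    series. *)
Lemma norm_expr_mx (R : realType) n (A : 'M[R]_n) k i j :
  `|(A ^+ k) i j| <= (\sum_i \sum_j `|A i j|) ^+ k.
Proof.
set b := \sum_i _.
have b0 : 0 <= b by apply: sumr_ge0 => a _; apply: sumr_ge0.
elim: k i j => [|k IH] i j.
  by rewrite !expr0 !mxE; case: (i == j); rewrite ?normr1 ?normr0.
rewrite exprS mxE (le_trans (ler_norm_sum _ _ _))// exprS.
have -> : b * b ^+ k = \sum_i \sum_j `|A i j| * b ^+ k.
  by rewrite mulr_suml; apply: eq_bigr => a _; rewrite mulr_suml.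
rewrite [leRHS](bigD1 i)//= -[leLHS]addr0 lerD//.
  by apply: ler_sum => l _; rewrite normrM ler_wpM2l.
by apply: sumr_ge0 => a _; apply: sumr_ge0 => c _; rewrite mulr_ge0 ?exprn_ge0.
Qed.

Section expm_entries.
Context {R : realType} {n : nat} (A : 'M[R]_n).

Let c i j k : R := (k`!%:R)^-1 * (A ^+ k) i j.

Let cvg_c i j x : cvgn (pseries (c i j) x).
Proof.
apply: normed_cvg => /=.
have b0 : 0 <= \sum_i \sum_j `|A i j|.
  by apply: sumr_ge0 => a _; apply: sumr_ge0.
apply: (@series_le_cvg _ _ (exp_coeff ((\sum_i \sum_j `|A i j|) * `|x|))).
- by move=> k; exact: normr_ge0.
- by move=> k; apply: exp_coeff_ge0; rewrite mulr_ge0.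
- move=> k /=; rewrite /exp_coeff /= exprMn normrM normrX normrM.
  rewrite ger0_norm ?invr_ge0//.
  rewrite [leRHS]mulrC mulrA ler_wpM2r ?exprn_ge0// ler_wpM2l ?invr_ge0//.
  exact: norm_expr_mx.
- exact: is_cvg_series_exp_coeff.
Qed.

Let exprZ_mx (s : R) k : (s *: A) ^+ k = s ^+ k *: A ^+ k.
Proof.
elim: k => [|k IH]; first by rewrite !expr0 scale1r.
by rewrite 3!exprS IH -!mulmxE -scalemxAl -scalemxAr scalerA.
Qed.

Let expmE (s : R) i j : expm (s *: A) i j = limn (pseries (c i j) s).
Proof.
suff -> : expm (s *: A) = \matrix_(i, j) limn (pseries (c i j) s).
  by rewrite mxE.
apply: cvg_lim => //; apply: cvg_mx => a b; rewrite mxE.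
suff -> : (fun k => series (fun k => (k`!%:R)^-1 *: (s *: A) ^+ k) k a b) =
    pseries (c a b) s by exact: cvg_c.
apply/funext => k; rewrite /pseries /series /= summxE.
apply: eq_bigr => l _; rewrite mxE exprZ_mx mxE /c; ring.
Qed.

Lemma expm_0 : expm (0 *: A) = 1%:M.
Proof.
apply: cvg_lim => //; apply: cvg_near_cst; near=> k.
rewrite /series /= big_mkord.
have k0 : (0 < k)%N by near: k; exists 1%N.
rewrite -(prednK k0) big_ord_recl /= fact0 invr1 scale1r expr0 big1 ?addr0//.
by move=> i _; rewrite scale0r exprS mul0r scaler0.
Unshelve. all: by end_near. Qed.

(** Each entry of s |-> e^(sA) is a scalar power series, differentiated term by
    term. *)
Lemma is_derive_expm (s : R) i j :
  is_derive s 1 (fun s => expm (s *: A) i j) ((expm (s *: A) *m A) i j).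
Proof.
have dE a b : pseries_diffs (c a b) = fun k => \sum_l c a l k * A l b.
  apply/funext => k; rewrite /pseries_diffs /c exprSr mxE big_distrr /=.
  rewrite big_distrr/=; apply: eq_bigr => l _.
  have := pseries_diffs_inv_fact R => /(congr1 (@^~ k)) <-.
  by rewrite /pseries_diffs; ring.
have sE x (f : 'I_n -> nat -> R) (v : 'I_n -> R) :
    (forall l, cvgn (pseries (f l) x)) ->
    pseries (fun k => \sum_l f l k * v l) x @ \oo -->
      \sum_l limn (pseries (f l) x) * v l.
  move=> cf; rewrite (_ : pseries _ _ =
      (fun N => \sum_l pseries (f l) x N * v l)); last first.
    apply/funext => N; rewrite /pseries /series /=.
    under [RHS]eq_bigr do rewrite mulr_suml.
    rewrite exchange_big /=; apply: eq_bigr => k _; rewrite mulr_suml.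
    by apply: eq_bigr => l _; ring.
  apply: cvg_big => [|l _]; first exact: add_continuous.
  by apply: cvgM; [exact: cf|exact: cvg_cst].
have c1 a b x : cvgn (pseries (pseries_diffs (c a b)) x).
  by rewrite dE; apply: cvgP; apply: sE.
have c2 a b x : cvgn (pseries (pseries_diffs (pseries_diffs (c a b))) x).
  have -> : pseries_diffs (pseries_diffs (c a b)) =
      fun k => \sum_l pseries_diffs (c a l) k * A l b.
    apply/funext => k; rewrite {1}/pseries_diffs dE mulr_sumr.
    by apply: eq_bigr => l _; rewrite /pseries_diffs; ring.
  by apply: cvgP; apply: sE.
rewrite (_ : (fun s => _) = fun s => limn (pseries (c i j) s)); last first.
  by apply/funext => x; rewrite expmE.
rewrite (_ : _ i j = limn (pseries (pseries_diffs (c i j)) s)).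
  apply: (@pseries_snd_diffs _ _ (`|s| + 1)) => //.
  by rewrite [ltRHS]ger0_norm ?ltrDl// addr_ge0.
rewrite dE mxE; apply/esym/cvg_lim => //.
by under eq_bigr do rewrite expmE; exact: sE.
Qed.

End expm_entries.

(** * Calculus on segments *)

Section calculus.
Context {R : realType}.
Implicit Types (f g F G : R -> R) (a b s t x : R).
Notation mu := (@lebesgue_measure R).

Lemma is_derive_cont f x df : is_derive x 1 f df -> {for x, continuous f}.
Proof. by move=> [df' _]; exact/differentiable_continuous/derivable1_diffP. Qed.

(** The differentiation rules for functions written pointwise rather than as
    sums and products in the ring of functions. *)
Lemma is_deriveD1 f g x df dg : is_derive x 1 f df -> is_derive x 1 g dg ->
  is_derive x 1 (fun y => f y + g y) (df + dg).
Proof. by move=> ? ?; exact: is_deriveD. Qed.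

Lemma is_deriveB1 f g x df dg : is_derive x 1 f df -> is_derive x 1 g dg ->
  is_derive x 1 (fun y => f y - g y) (df - dg).
Proof. by move=> ? ?; exact: is_deriveB. Qed.

Lemma is_deriveM1 f g x df dg : is_derive x 1 f df -> is_derive x 1 g dg ->
  is_derive x 1 (fun y => f y * g y) (f x * dg + g x * df).
Proof. by move=> ? ?; exact: is_deriveM. Qed.

Lemma is_derive_id1 x : is_derive x 1 (fun y : R => y) 1.
Proof. exact: is_derive_id. Qed.

Lemma is_derive_cst1 (c x : R) : is_derive x 1 (fun=> c) 0.
Proof. exact: is_derive_cst. Qed.

Lemma is_derive_sum1 (n : nat) (f df : 'I_n -> R -> R) x :
  (forall i, is_derive x 1 (f i) (df i x)) ->
  is_derive x 1 (fun y => \sum_i f i y) (\sum_i df i x).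
Proof.
move=> H; have := @is_derive_sum R R R n f x 1 (fun i => df i x) H.
by congr (is_derive _ _ _ _); apply/funext => y; rewrite fct_sumE.
Qed.

Lemma is_derive_reflect f t x df : is_derive (t - x) 1 f df ->
  is_derive x 1 (fun y => f (t - y)) (- df).
Proof.
move=> H; rewrite -mulrN1; apply: (@is_derive1_comp R f (fun y => t - y)).
rewrite -[X in is_derive _ _ _ X]sub0r.
exact: is_deriveB1 (is_derive_cst1 _ _) (is_derive_id1 _).
Qed.

Lemma integrable_cont f a b :
  (forall x, a <= x <= b -> {for x, continuous f}) ->
  mu.-integrable `[a, b] (EFin \o f).
Proof.
move=> cf; apply: continuous_compact_integrable; first exact: segment_compact.
by apply: continuous_in_subspaceT => x; rewrite inE/= in_itv => /cf.
Qed.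

Lemma Rintegral_FTC F f a b : a <= b ->
  (forall x, a <= x <= b -> is_derive x 1 F (f x)) ->
  (forall x, a <= x <= b -> {for x, continuous f}) ->
  \int[mu]_(x in `[a, b]) f x = F b - F a.
Proof.
rewrite le_eqVlt => /predU1P[<- _ _|ab dF cf].
  by rewrite set_itv1 Rintegral_set1 subrr.
rewrite /Rintegral (@continuous_FTC2 _ f F)//=.
- by apply: continuous_in_subspaceT => x; rewrite inE/= in_itv => /cf.
- have cF x : a <= x <= b -> F x @[x --> x] --> F x.
    by move=> /dF/is_derive_cont.
  split.
  + by move=> x; rewrite in_itv/= => /andP[ax xb]; have [] := dF x; rewrite // !ltW.
  + by apply: cvg_at_right_filter; apply: cF; rewrite lexx ltW.
  + by apply: cvg_at_left_filter; apply: cF; rewrite lexx ltW.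
- move=> x; rewrite in_itv/= => /andP[ax xb].
  by rewrite derive1E; apply: derive_val; apply: dF; rewrite !ltW.
Qed.

(** Starting the primitive at a - 1 makes it differentiable at the endpoint a
    too. *)
Lemma antiderivative f a b : continuous f ->
  exists F, forall x, a <= x <= b -> is_derive x 1 F (f x).
Proof.
move=> cf; exists (fun x => \int[mu]_(y in `[a - 1, x]) f y) => x /andP[ax xb].
have [||||d e] := @continuous_FTC1_closed R f (a - 1) x (b + 1).
- by rewrite (le_lt_trans xb)// ltrDl.
- by apply: integrable_cont => y _; exact: cf.
- by rewrite ltrBlDr (le_lt_trans ax)// ltrDl.
- exact: cf.
by constructor; [exact: d|rewrite -derive1E; exact: e].
Qed.

Lemma EFin_Rintegral d (T : measurableType d) (m : {measure set T -> \bar R})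
    (D : set T) (h : T -> R) : measurable D -> m.-integrable D (EFin \o h) ->
  (\int[m]_(z in D) h z)%:E = (\int[m]_(z in D) (h z)%:E)%E.
Proof. by move=> mD ih; rewrite /Rintegral fineK//; exact: integrable_fin_num. Qed.

Lemma integrable_patch d (T : measurableType d) (m : {measure set T -> \bar R})
    (D E : set T) (h : T -> \bar R) : measurable D -> measurable E ->
  m.-integrable (D `&` E) h -> m.-integrable D (h \_ E).
Proof. by move=> mD mE /integrable_restrict; exact. Qed.

Lemma Rintegral_sum d (T : measurableType d) (m : {measure set T -> \bar R})
    (D : set T) (n : nat) (h : 'I_n -> T -> R) : measurable D ->
  (forall i, m.-integrable D (EFin \o h i)) ->
  m.-integrable D (EFin \o (fun z => \sum_i h i z)) /\
  \int[m]_(z in D) (\sum_i h i z) = \sum_i \int[m]_(z in D) h i z.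
Proof.
move=> mD; elim: n h => [|n IH] h ih.
  split.
    rewrite (_ : _ \o _ = fun=> 0%E); first exact: integrable0.
    by apply/funext => z /=; rewrite big_ord0.
  rewrite big_ord0; under eq_Rintegral do rewrite big_ord0.
  by rewrite Rintegral_cst// mul0r.
have [i1 e1] := IH (fun i => h (lift ord0 i)) (fun i => ih _).
split.
  rewrite (_ : _ \o _ = (fun z => (EFin \o h ord0) z +
    (EFin \o (fun z => (\sum_i h (lift ord0 i) z)%R)) z)%E); first exact: integrableD.
  by apply/funext => x /=; rewrite big_ord_recl EFinD.
rewrite big_ord_recl -e1 -RintegralD//.
by apply: eq_Rintegral => x _; rewrite big_ord_recl.
Qed.

Lemma Rintegral_reflect f t : 0 <= t -> continuous f ->
  \int[mu]_(s in `[0, t]) f (t - s) = \int[mu]_(s in `[0, t]) f s.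
Proof.
move=> t0 cf; have [F dF] := @antiderivative f 0 t cf.
have dG s : 0 <= s <= t -> is_derive s 1 (fun s => - F (t - s)) (f (t - s)).
  move=> /andP[s0 st]; rewrite -[f _]opprK; apply: is_deriveN.
  by apply: is_derive_reflect; apply: dF; rewrite subr_ge0 st gerBl.
have cG s : {for s, continuous (fun s => f (t - s))}.
  apply: (@continuous_comp _ _ _ (fun s => t - s) f); last exact: cf.
  exact: is_derive_cont (is_deriveB1 (is_derive_cst1 t s) (is_derive_id1 s)).
rewrite (Rintegral_FTC t0 dF (fun s _ => cf s)).
rewrite (Rintegral_FTC t0 dG (fun s _ => cG s)).
by rewrite subrr subr0 opprK addrC.
Qed.

End calculus.

(** * Iterated integrals over a rectangle *)

(** Extension by zero outside the rectangle reduces these statements to the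
    Fubini and Tonelli theorems on the whole product space. *)
Section fubini_on.
Context d1 d2 (T1 : measurableType d1) (T2 : measurableType d2) (R : realType).
Variables (m1 : {sigma_finite_measure set T1 -> \bar R})
  (m2 : {sigma_finite_measure set T2 -> \bar R}).
Variables (D : set T1) (E : set T2).
Hypotheses (mD : measurable D) (mE : measurable E).
Implicit Types f : T1 * T2 -> \bar R.
Local Open Scope ereal_scope.

Let patchX1 f x y : x \in D -> (f \_ (D `*` E)) (x, y) = ((fun y => f (x, y)) \_ E) y.
Proof. by move=> xD; rewrite !patchE in_setX /= xD. Qed.

Let patchX2 f x y : y \in E -> (f \_ (D `*` E)) (x, y) = ((fun x => f (x, y)) \_ D) x.
Proof. by move=> yE; rewrite !patchE in_setX /= yE andbT. Qed.

Let patchN1 f x y : x \notin D -> (f \_ (D `*` E)) (x, y) = 0.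
Proof. by move=> xD; rewrite patchE in_setX /= (negbTE xD). Qed.

Let patchN2 f x y : y \notin E -> (f \_ (D `*` E)) (x, y) = 0.
Proof. by move=> yE; rewrite patchE in_setX /= (negbTE yE) andbF. Qed.

Let iter12 f : \int[m1]_(x in D) \int[m2]_(y in E) f (x, y) =
  \int[m1]_x \int[m2]_y (f \_ (D `*` E)) (x, y).
Proof.
rewrite integral_mkcond; apply: eq_integral => x _; rewrite patchE.
case: ifPn => xD; last by rewrite integral0_eq// => y _; exact: patchN1.
by rewrite integral_mkcond; apply: eq_integral => y _; rewrite patchX1.
Qed.

Let iter21 f : \int[m2]_(y in E) \int[m1]_(x in D) f (x, y) =
  \int[m2]_y \int[m1]_x (f \_ (D `*` E)) (x, y).
Proof.
rewrite integral_mkcond; apply: eq_integral => x _; rewrite patchE.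
case: ifPn => xD; last by rewrite integral0_eq// => y _; exact: patchN2.
by rewrite integral_mkcond; apply: eq_integral => y _; rewrite patchX2.
Qed.

Let mpatch f : measurable_fun (D `*` E) f -> measurable_fun setT (f \_ (D `*` E)).
Proof.
move=> mf; apply/(measurable_restrictT _ _).1; [exact: measurableX|exact: mf].
Qed.

Let patch_ge0 f : (forall x, 0 <= f x) -> forall x, 0 <= (f \_ (D `*` E)) x.
Proof. by move=> f0 x; rewrite patchE; case: ifPn. Qed.

Lemma measurable_section1 d' (T' : measurableType d') (f : T1 * T2 -> T') x :
  D x -> measurable_fun (D `*` E) f -> measurable_fun E (fun y => f (x, y)).
Proof.
move=> Dx mf; apply: (measurable_comp (measurableX mD mE) _ mf).
  by move=> _ [y Ey <-].
by apply: measurable_funTS; exact: measurable_pair1.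
Qed.

Lemma measurable_section2 d' (T' : measurableType d') (f : T1 * T2 -> T') y :
  E y -> measurable_fun (D `*` E) f -> measurable_fun D (fun x => f (x, y)).
Proof.
move=> Ey mf; apply: (measurable_comp (measurableX mD mE) _ mf).
  by move=> _ [x Dx <-].
by apply: measurable_funTS; exact: measurable_pair2.
Qed.

Lemma tonelli_on f : measurable_fun (D `*` E) f -> (forall x, 0 <= f x) ->
  \int[m1]_(x in D) \int[m2]_(y in E) f (x, y) =
  \int[m2]_(y in E) \int[m1]_(x in D) f (x, y).
Proof.
move=> mf f0; rewrite iter12 iter21 fubini_tonelli//; first exact: mpatch.
exact: patch_ge0.
Qed.

Lemma measurable_integral_on f : measurable_fun (D `*` E) f ->
  (forall x, 0 <= f x) ->
  measurable_fun E (fun y => \int[m1]_(x in D) f (x, y)).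
Proof.
move=> mf f0.
apply: (@eq_measurable_fun _ _ _ _ _ (fubini_G m1 (f \_ (D `*` E)))).
  move=> y yE; rewrite /fubini_G [RHS]integral_mkcond.
  by apply: eq_integral => x _; rewrite patchX2.
apply: measurable_funTS; apply: measurable_fun_fubini_tonelli_G.
  exact: mpatch.
exact: patch_ge0.
Qed.

Lemma measurable_integral_EFin_on (f : T1 * T2 -> R) :
  measurable_fun (D `*` E) f ->
  measurable_fun E (fun y => \int[m1]_(x in D) (f (x, y))%:E).
Proof.
move=> mf; have mf' := (measurable_EFinP _ _).2 mf.
apply: (@eq_measurable_fun _ _ _ _ _ (fun y =>
    \int[m1]_(x in D) (EFin \o f)^\+ (x, y) -
    \int[m1]_(x in D) (EFin \o f)^\- (x, y))).
  move=> y _ /=; rewrite [RHS]integralE.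
  by congr (_ - _); apply: eq_integral => x _; rewrite ?funeposE ?funenegE.
apply: emeasurable_funB.
  apply: (@measurable_integral_on (EFin \o f)^\+) => //.
  exact: measurable_funepos.
apply: (@measurable_integral_on (EFin \o f)^\-) => //.
exact: measurable_funeneg.
Qed.

Lemma measurable_Rintegral_on (f : T1 * T2 -> R) :
  measurable_fun (D `*` E) f ->
  measurable_fun E (fun y => (\int[m1]_(x in D) f (x, y))%R).
Proof.
move=> mf; apply: (@measurableT_comp _ _ _ _ _ _ fine) => //.
exact: measurable_integral_EFin_on.
Qed.

Section integrable.
Variable f : T1 * T2 -> R.
Hypothesis mf : measurable_fun (D `*` E) f.
Hypothesis fi :
  \int[m1]_(x in D) \int[m2]_(y in E) `|f (x, y)|%:E < +oo.

Let int_patch : (m1 \x m2).-integrable setT ((EFin \o f) \_ (D `*` E)).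
Proof.
apply/integrable12ltyP.
  by apply: mpatch; apply/measurable_EFinP; exact: mf.
rewrite (le_lt_trans _ fi)// (iter12 (fun z => `|f z|%:E)).
rewrite le_eqVlt; apply/orP; left; apply/eqP.
apply: eq_integral => x _; apply: eq_integral => y _ /=.
by rewrite !patchE; case: ifPn => //; rewrite abse0.
Qed.

Lemma fubini_on : \int[m1]_(x in D) \int[m2]_(y in E) (f (x, y))%:E =
  \int[m2]_(y in E) \int[m1]_(x in D) (f (x, y))%:E.
Proof.
by rewrite (iter12 (EFin \o f)) (iter21 (EFin \o f)); exact: Fubini.
Qed.

Lemma ae_integrable_on : {ae m2, forall y, E y ->
  m1.-integrable D (fun x => (f (x, y))%:E)}.
Proof.
have := ae_integrable2 int_patch; apply: filterS => y iy Ey.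
have := (@integrable_restrict _ T1 R m1 D mD setT measurableT
  (fun x => (f (x, y))%:E)).2.
rewrite setTI; apply; congr (_.-integrable _ _): iy.
by apply/funext => x; rewrite patchX2//; exact/mem_set.
Qed.

End integrable.
End fubini_on.

(** * Integration by parts for primitives of integrable functions *)

Section integration_by_parts_primitive.
Context {R : realType}.
Notation mu := (@lebesgue_measure R).
Implicit Types (f h phi dphi : R -> R).

Lemma integrable_cont_mul h f (a b : R) :
  {within `[a, b], continuous h} -> mu.-integrable `[a, b] (EFin \o f) ->
  mu.-integrable `[a, b] (EFin \o (fun x => h x * f x)).
Proof.
move=> ch fi.
rewrite (_ : _ \o _ = ((EFin \o h) \* (EFin \o f))%E); last first.
  by apply/funext => x /=; rewrite EFinM.
have mh : measurable_fun `[a, b] h by exact: subspace_continuous_measurable_fun.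
have bh : [bounded h x | x in `[a, b]].
  have := compact_bounded (continuous_compact ch (@segment_compact R a b)).
  rewrite /bounded_set /bounded_near.
  apply: (@filterS _ _ _ _ _) => M /= HM x xab.
  by apply: HM; exists x.
have := @integrableMr _ (measurableTypeR R) R mu `[a, b] (measurable_itv _) h _ mh bh fi.
exact.
Qed.

(** The primitive of f is differentiable only almost everywhere.  The last
    integral is that of dphi r * f s over the triangle 0 <= s <= r <= t;
    integrating over r first turns it into the integral of
    (phi t - phi s) * f s. *)
Lemma ibp_primitive phi dphi f (t : R) : 0 <= t ->
  (forall s : R, is_derive s 1 phi (dphi s)) -> continuous dphi ->
  mu.-integrable `[0, t] (EFin \o f) ->
  \int[mu]_(s in `[0, t]) (phi s * f s) =
    phi t * \int[mu]_(s in `[0, t]) f s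
    - \int[mu]_(r in `[0, t]) (dphi r * \int[mu]_(s in `[0, r]) f s).
Proof.
move=> t0 dP cd fi.
have cP (s : R) : {for s, continuous phi} by apply: is_derive_cont (dP s).
(* The integrand over the triangle, extended by zero to the square. *)
pose G (z : R * R) := dphi z.1 * (if z.2 <= z.1 then f z.2 else 0).
have mD : measurable (`[0, t] : set R) by [].
have mf : measurable_fun `[0, t] f by have /integrableP[/measurable_EFinP] := fi.
have mG : @measurable_fun _ _ (measurableTypeR R * measurableTypeR R)%type R
    (`[0, t] `*` `[0, t]) G.
  apply: (@measurable_funM _ (measurableTypeR R * measurableTypeR R)%type R _ (dphi \o fst)).
    apply: measurable_funTS; apply: (measurableT_comp _ measurable_fst).
    exact: continuous_measurable_fun.
  apply: measurable_fun_if; [exact: measurableX| |..].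
  - apply: measurable_fun_ler; apply: measurable_funTS.
      exact: measurable_snd.
    exact: measurable_fst.
  - apply: (@measurable_funS _ _ _ _ (setT `*` `[0, t])).
    + exact: measurableX.
    + by move=> z [[_ ?] _].
    + apply: (measurable_comp (measurable_itv `[0, t]) _ mf).
        by move=> _ [z [_ ?] <-].
      by apply: measurable_funTS; exact: measurable_snd.
  - exact: measurable_cst.
have fi' (r : R) : r <= t -> mu.-integrable `[0, r] (EFin \o f).
  move=> rt; apply: (integrableS _ _ _ fi) => //.
  by apply: subset_itvl; rewrite bnd_simp.
have cdw (a b : R) : {within `[a, b], continuous dphi}.
  exact: continuous_subspaceT.
have di (a b : R) : mu.-integrable `[a, b] (EFin \o dphi).
  by apply: integrable_cont => x _; exact: cd.
have wi : mu.-integrable `[0, t]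
    (EFin \o (fun r => dphi r * \int[mu]_(s in `[0, r]) f s)).
  apply: continuous_compact_integrable; first exact: segment_compact.
  have cw := parameterized_integral_continuous t0 fi.
  by move=> r; apply: cvgM; [exact: cdw|exact: cw].
have sub1 (r : R) : r <= t -> [set` `[0, t]] `&` [set` `[0, r]] = [set` `[0, r]].
  move=> rt; apply/setIidPr => x /=; rewrite !in_itv /= => /andP[-> xr] /=.
  exact: le_trans xr rt.
have sub2 (s : R) : 0 <= s -> [set` `[0, t]] `&` [set` `[s, t]] = [set` `[s, t]].
  move=> s0; apply/setIidPr => x /=; rewrite !in_itv /= => /andP[sx ->] /=.
  by rewrite andbT (le_trans s0 sx).
have innerL (r : R) : r \in [set` `[0%R, t]] ->
  (\int[mu]_(s in `[0%R, t]) (G (r, s))%:E =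
   (dphi r * \int[mu]_(s in `[0%R, r]) f s)%R%:E)%E.
  rewrite inE/= in_itv/= => /andP[r0 rt].
  transitivity (\int[mu]_(s in `[0%R, t])
      ((dphi r)%:E * ((EFin \o f) \_ `[0%R, r]) s))%E.
    apply: eq_integral => s; rewrite inE/= in_itv/= => /andP[s0 st].
    by rewrite /G/= patchE mem_setE in_itv/= s0/=; case: ifP; rewrite ?mulr0 ?mule0.
  rewrite integralZl//; last first.
    by apply: integrable_patch => //; rewrite sub1//; exact: fi'.
  by rewrite -integral_mkcondr sub1// EFinM EFin_Rintegral//; exact: fi'.
have innerR (s : R) : s \in [set` `[0%R, t]] ->
  (\int[mu]_(r in `[0%R, t]) (G (r, s))%:E = (phi t * f s - phi s * f s)%R%:E)%E.
  rewrite inE/= in_itv/= => /andP[s0 st].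
  transitivity (\int[mu]_(r in `[0%R, t])
      ((f s)%:E * ((EFin \o dphi) \_ `[s, t]) r))%E.
    apply: eq_integral => r; rewrite inE/= in_itv/= => /andP[r0 rt].
    rewrite /G/= patchE mem_setE in_itv/= rt andbT.
    by case: ifP; rewrite ?mulr0 ?mule0// mulrC.
  rewrite integralZl//; last first.
    by apply: integrable_patch => //; rewrite sub2//; exact: di.
  rewrite -integral_mkcondr sub2// -EFin_Rintegral//
    (Rintegral_FTC st (fun x _ => dP x) (fun x _ => cd x)).
  by rewrite -EFinM; congr EFin; ring.
have Gi : (\int[mu]_(r in `[0%R, t]) \int[mu]_(s in `[0%R, t]) `|G (r, s)|%:E < +oo)%E.
  have /integrableP[_ fin] := fi; have /integrableP[_ din] := di 0 t.
  have mdn : measurable_fun `[0%R, t] (fun r : measurableTypeR R => (`|dphi r|%:E)%E).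
    apply/measurable_EFinP; apply: measurableT_comp => //.
    exact: subspace_continuous_measurable_fun.
  have mfn : measurable_fun `[0%R, t] (fun r : measurableTypeR R => (`|f r|%:E)%E).
    by apply/measurable_EFinP; exact: measurableT_comp.
  have mGn : @measurable_fun _ _ (measurableTypeR R * measurableTypeR R)%type _
      (`[0, t] `*` `[0, t]) (fun z => (`|G z|%:E)%E).
    by apply/measurable_EFinP; exact: measurableT_comp.
  rewrite (tonelli_on mu mu mD mD mGn)//.
  apply: (@le_lt_trans _ _ (\int[mu]_(s in `[0%R, t])
     (`|f s|%:E * \int[mu]_(r in `[0%R, t]) `|dphi r|%:E))%E).
    apply: ge0_le_integral => //.
    - by move=> s _; exact: integral_ge0.
    - exact: (measurable_integral_on mu mD mD mGn).
    - exact: emeasurable_funM.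
    - move=> s st; rewrite -ge0_integralZl//.
      apply: ge0_le_integral => //.
      + exact: (measurable_section2 mD mD st mGn).
      + exact: emeasurable_funM.
      + move=> r _; rewrite /G/= normrM EFinM muleC lee_wpmul2r ?lee_fin//.
        by case: ifP => // _; rewrite normr0.
  rewrite ge0_integralZr//; last exact: integral_ge0.
  by rewrite lte_mul_pinfty//; [exact: integral_ge0|rewrite ge0_fin_numE// integral_ge0].
have := @fubini_on _ _ _ _ R mu mu _ _ mD mD _ mG Gi.
rewrite [X in X = _](_ : _ = (\int[mu]_(r in `[0%R, t])
    (dphi r * \int[mu]_(s in `[0%R, r]) f s)%R%:E)%E); last exact: eq_integral.
rewrite [X in _ = X](_ : _ = (\int[mu]_(s in `[0%R, t])
    (phi t * f s - phi s * f s)%R%:E)%E); last exact: eq_integral.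
have pf := integrable_cont_mul (continuous_subspaceT (fun s => cP s)) fi.
have ptf : mu.-integrable `[0, t] (EFin \o (fun s => phi t * f s)).
  by apply: (integrable_cont_mul _ fi); apply: continuous_subspaceT => s; exact: cvg_cst.
rewrite -EFin_Rintegral// -EFin_Rintegral//; last first.
  by rewrite (_ : _ \o _ = (EFin \o (fun s => phi t * f s)%R) \-
    (EFin \o (fun s => phi s * f s)%R))%E//; exact: integrableB.
move=> [->]; rewrite RintegralB// RintegralZl//; ring.
Qed.
End integration_by_parts_primitive.

(** * Double integral of the covariance kernel of the noise part *)

Section noise_kernel.
Context {R : realType}.
Notation mu := (@lebesgue_measure R).

(** For a process W with covariance min(s, r), this is the covariance of the
    process e(t) W(t) / t + h(s) W(s). *)
Definition noise_kernel (t : R) (e h : R -> R) (s r : R) : R :=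
  e t ^+ 2 / t + e t * h s * s / t + e t * h r * r / t + h s * h r * Num.min s r.

Lemma Rintegral_split (f : R -> R) (s t : R) : 0 <= s <= t ->
  mu.-integrable `[0, t] (EFin \o f) ->
  \int[mu]_(r in `[0, t]) f r =
  \int[mu]_(r in `[0, s]) f r + \int[mu]_(r in `[s, t]) f r.
Proof.
move=> /andP[s0 st] fi.
have ist : mu.-integrable `]s, t] (EFin \o f).
  apply: (integrableS _ _ _ fi) => // x /=; rewrite !in_itv/= => /andP[/ltW sx ->].
  by rewrite (le_trans s0 sx).
rewrite -(@Rintegral_itv_obnd_cbnd _ s (BRight t) f ist).
by rewrite -(Rintegral_itvB fi) ?bnd_simp// addrC subrK.
Qed.

Section one.
Variables (t : R) (e h Psi : R -> R).
Hypotheses (t0 : 0 < t) (de : forall s : R, is_derive s 1 e (- h s))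
  (ch : continuous h)
  (dPsi : forall s : R, 0 <= s <= t -> is_derive s 1 Psi (e s)) (Psi0 : Psi 0 = 0).

Let ce : continuous e. Proof. by move=> s; exact: is_derive_cont (de s). Qed.

Let cont_min (s : R) : continuous (fun r : R => Num.min s r).
Proof.
move=> r; apply: (@continuous_min R R (fun=> s) id) => //.
exact: cst_continuous.
Qed.

Lemma noise_kernel_cont (s : R) : continuous (noise_kernel t e h s).
Proof.
move=> r; rewrite /noise_kernel.
apply: cvgD; last by apply: cvgM; [apply: cvgM; [exact: cvg_cst|exact: ch]|exact: cont_min].
apply: cvgD; first exact: cvg_cst.
apply: cvgM; last exact: cvg_cst.
by apply: cvgM; [apply: cvgM; [exact: cvg_cst|exact: ch]|exact: cvg_id].
Qed.

(** The kernel has a kink at r = s; on either side of it the integrand has an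
    elementary primitive in terms of the primitive Psi of e. *)
Lemma noise_kernel_inner (s : R) : 0 <= s <= t ->
  \int[mu]_(r in `[0, t]) noise_kernel t e h s r = e t / t * Psi t + h s * Psi s.
Proof.
move=> /[dup] st /andP[s0 st'].
have tn0 : t != 0 by rewrite gt_eqF.
rewrite (Rintegral_split st); last first.
  by apply: integrable_cont => x _; exact: noise_kernel_cont.
pose c := e t ^+ 2 / t + e t * h s * s / t.
pose k1 r := c + e t / t * (h r * r) + h s * (h r * r).
pose k2 r := c + e t / t * (h r * r) + h s * s * h r.
(* k1 and k2 are the kernel on [0, s] and on [s, t], K1 and K2 their primitives. *)
pose K1 r := c * r + e t / t * (Psi r - r * e r) + h s * (Psi r - r * e r).
pose K2 r := c * r + e t / t * (Psi r - r * e r) + h s * s * (- e r).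
have dPe (r : R) : 0 <= r <= t -> is_derive r 1 (fun r => Psi r - r * e r) (h r * r).
  move=> rt; rewrite (_ : h r * r = e r - (r * - h r + e r * 1)); last by ring.
  exact: is_deriveB1 (dPsi rt) (is_deriveM1 (is_derive_id1 r) (de r)).
have dc (a : R) (f : R -> R) (df r : R) : is_derive r 1 f df ->
    is_derive r 1 (fun r => a * f r) (a * df).
  move=> df'; rewrite (_ : a * df = a * df + f r * 0); last by rewrite mulr0 addr0.
  exact: is_deriveM1 (is_derive_cst1 a r) df'.
have dK1 (r : R) : 0 <= r <= s -> is_derive r 1 K1 (k1 r).
  move=> /andP[r0 rs]; have rt : 0 <= r <= t by rewrite r0 (le_trans rs).
  have c1 := dc c _ _ _ (is_derive_id1 r); rewrite mulr1 in c1.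
  exact: is_deriveD1 (is_deriveD1 c1 (dc _ _ _ _ (dPe r rt))) (dc _ _ _ _ (dPe r rt)).
have dK2 (r : R) : s <= r <= t -> is_derive r 1 K2 (k2 r).
  move=> /andP[sr rt']; have rt : 0 <= r <= t by rewrite rt' (le_trans s0).
  have c1 := dc c _ _ _ (is_derive_id1 r); rewrite mulr1 in c1.
  have de' : is_derive r 1 (fun r => - e r) (h r).
    by rewrite -[h r]opprK; exact: is_deriveN (de r).
  exact: is_deriveD1 (is_deriveD1 c1 (dc _ _ _ _ (dPe r rt))) (dc _ _ _ _ de').
have chr (a : R) : continuous (fun r => a * (h r * r)).
  by move=> r; apply: cvgM; [exact: cvg_cst|apply: cvgM; [exact: ch|exact: cvg_id]].
have ck1 : continuous k1.
  move=> r; apply: cvgD; last exact: chr.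
  by apply: cvgD; [exact: cvg_cst|exact: chr].
have ck2 : continuous k2.
  move=> r; apply: cvgD; last by apply: cvgM; [exact: cvg_cst|exact: ch].
  by apply: cvgD; [exact: cvg_cst|exact: chr].
rewrite (_ : \int[mu]_(r in `[0, s]) _ = \int[mu]_(r in `[0, s]) k1 r); last first.
  apply: eq_Rintegral => r; rewrite inE/= in_itv/= => /andP[r0 rs].
  by rewrite /noise_kernel /k1 /c min_r//; ring.
rewrite (_ : \int[mu]_(r in `[s, t]) _ = \int[mu]_(r in `[s, t]) k2 r); last first.
  apply: eq_Rintegral => r; rewrite inE/= in_itv/= => /andP[sr rt].
  by rewrite /noise_kernel /k2 /c min_l//; ring.
rewrite (Rintegral_FTC s0 dK1 (fun x _ => ck1 x)).
rewrite (Rintegral_FTC st' dK2 (fun x _ => ck2 x)).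
by rewrite /K1 /K2 /c Psi0; field.
Qed.

(** Since e' = - h, the difference of the integrands is the derivative of
    (e t / t * Psi t) * s - e s * Psi s, which vanishes at 0 and at t. *)
Lemma noise_kernel_outer :
  \int[mu]_(s in `[0, t]) (e t / t * Psi t + h s * Psi s) =
  \int[mu]_(s in `[0, t]) e s ^+ 2.
Proof.
have tn0 : t != 0 by rewrite gt_eqF.
have cP (s : R) : 0 <= s <= t -> {for s, continuous Psi}.
  by move=> st; exact: is_derive_cont (dPsi st).
have ce2 (s : R) : {for s, continuous (fun s => e s ^+ 2)}.
  by apply: cvgM; exact: ce.
have cL (s : R) : 0 <= s <= t -> {for s, continuous (fun s => e t / t * Psi t + h s * Psi s)}.
  by move=> st; apply: cvgD; [exact: cvg_cst|apply: cvgM; [exact: ch|exact: cP]].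
apply/eqP; rewrite -subr_eq0 -RintegralB//; [|exact: integrable_cont..].
pose F s := (e t / t * Psi t) * s - e s * Psi s.
have dF (s : R) : 0 <= s <= t ->
    is_derive s 1 F (e t / t * Psi t + h s * Psi s - e s ^+ 2).
  move=> st; rewrite (_ : _ - _ = (e t / t * Psi t * 1 + s * 0) -
    (e s * e s + Psi s * - h s)); last by ring.
  exact: is_deriveB1 (is_deriveM1 (is_derive_cst1 _ _) (is_derive_id1 s))
    (is_deriveM1 (de s) (dPsi st)).
rewrite (Rintegral_FTC (ltW t0) dF).
  by rewrite /F Psi0; apply/eqP; field.
by move=> s st; apply: cvgB; [exact: cL|exact: ce2].
Qed.

End one.

(** An Ito isometry without stochastic integrals: when e' = - h and W(0) = 0,
    the time integral of e(t) W(t) / t + h(s) W(s) over [0, t] is, formally,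
    the integral of e against dW, whose variance is the integral of e^2. *)
Lemma noise_kernel_integral (m : nat) (e h : 'I_m -> R -> R) (t : R) : 0 < t ->
  (forall l (s : R), is_derive s 1 (e l) (- h l s)) -> (forall l, continuous (h l)) ->
  (\int[mu]_(s in `[0%R, t]) \int[mu]_(r in `[0%R, t])
     (\sum_l noise_kernel t (e l) (h l) s r)%:E =
   (\int[mu]_(s in `[0%R, t]) \sum_l e l s ^+ 2)%R%:E)%E.
Proof.
move=> t0 de ch.
have ce l (s : R) : {for s, continuous (e l)} by exact: is_derive_cont (de l s).
have [Psi HPsi] : exists Psi : 'I_m -> R -> R, forall l,
    (forall s : R, 0 <= s <= t -> is_derive s 1 (Psi l) (e l s)) /\ Psi l 0 = 0.
  suff /choice[f Hf] : forall l, exists Psi : R -> R,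
      (forall s : R, 0 <= s <= t -> is_derive s 1 Psi (e l s)) /\ Psi 0 = 0.
    by exists f.
  move=> l; have [F dF] := @antiderivative R (e l) 0 t (ce l).
  exists (fun s => F s - F 0); split; last by rewrite subrr.
  move=> s st; rewrite -[e l s]subr0.
  exact: is_deriveB1 (dF s st) (is_derive_cst1 _ _).
have dPsi l := (HPsi l).1; have Psi0 l := (HPsi l).2.
pose J l s := e l t / t * Psi l t + h l s * Psi l s.
have iJ l : mu.-integrable `[0, t] (EFin \o J l).
  apply: integrable_cont => s st; apply: cvgD; first exact: cvg_cst.
  by apply: cvgM; [exact: ch|exact: is_derive_cont (dPsi l s st)].
rewrite (_ : (\int[mu]_(s in _) _)%E =
    (\int[mu]_(s in `[0%R, t]) (\sum_l J l s)%:E)%E); last first.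
  apply: eq_integral => s; rewrite inE/= in_itv/= => st.
  have ik l : mu.-integrable `[0, t] (EFin \o noise_kernel t (e l) (h l) s).
    by apply: integrable_cont => x _; exact: noise_kernel_cont.
  have [isum _] := @Rintegral_sum R _ (measurableTypeR R) mu _ _ _ (measurable_itv `[0, t]) ik.
  rewrite -EFin_Rintegral//; congr EFin.
  rewrite (@Rintegral_sum R _ (measurableTypeR R) mu _ _ _ (measurable_itv `[0, t]) ik).2.
  apply: eq_bigr => l _; exact: noise_kernel_inner.
have [isum eJ] := @Rintegral_sum R _ (measurableTypeR R) mu _ _ _ (measurable_itv `[0, t]) iJ.
rewrite -EFin_Rintegral// eJ; congr EFin.
rewrite (@Rintegral_sum R _ (measurableTypeR R) mu _ _ (fun l s => e l s ^+ 2)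
  (measurable_itv `[0, t]) _).2//; last first.
  by move=> l; apply: integrable_cont => s _; apply: cvgM; exact: ce.
by apply: eq_bigr => l _; exact: noise_kernel_outer.
Qed.

End noise_kernel.

(** * Second moment of the time integral of a process *)

Lemma normM_le_sqr (R : realFieldType) (a b : R) : `|a * b| <= a ^+ 2 + b ^+ 2.
Proof.
rewrite normrM -(real_normK (num_real a)) -(real_normK (num_real b)).
by have := normr_ge0 a; have := normr_ge0 b; nra.
Qed.

(** The process g is indexed by a set D of finite positive measure tau and its
    second moments are bounded by c; W is its integral over D. *)
Section second_moment.
Context d1 d2 (T1 : measurableType d1) (T2 : measurableType d2) (R : realType).
Variables (m : {sigma_finite_measure set T1 -> \bar R}) (P : probability T2 R).
Variables (D : set T1) (tau c : R) (g : T1 * T2 -> R).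
Hypotheses (mD : measurable D) (mDtau : m D = tau%:E) (tau0 : 0 < tau).
Hypothesis mg : measurable_fun (D `*` setT) g.
Hypothesis gc : forall s, D s -> (\int[P]_w (g (s, w) ^+ 2)%:E <= c%:E)%E.
Local Open Scope ereal_scope.

Let W w : R := (\int[m]_(s in D) g (s, w))%R.

Let mg2 : measurable_fun (D `*` setT) (fun z => (g z ^+ 2)%R).
Proof. exact: measurable_funX. Qed.

Let mg2' : measurable_fun (D `*` setT) (fun z => (g z ^+ 2)%:E).
Proof. exact/measurable_EFinP. Qed.

Let g2_ge0 (x : T1 * T2) : 0 <= (g x ^+ 2)%:E.
Proof. by rewrite lee_fin sqr_ge0. Qed.

Lemma measurable_path_integral : measurable_fun setT W.
Proof. exact: (measurable_Rintegral_on m mD measurableT mg). Qed.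

Lemma integral_sq_bound : \int[P]_w \int[m]_(s in D) (g (s, w) ^+ 2)%:E <= (c * tau)%:E.
Proof.
rewrite -(tonelli_on m P mD measurableT mg2' g2_ge0).
apply: (@le_trans _ _ (\int[m]_(s in D) c%:E)); last first.
  by rewrite integral_cst// EFinM -mDtau.
have mswap : measurable_fun D (fun s => \int[P]_w (g (s, w) ^+ 2)%:E).
  have ms : measurable_fun (setT `*` D) (fun z : T2 * T1 => (g (z.2, z.1) ^+ 2)%:E).
    apply: (measurable_comp (measurableX mD measurableT) _ mg2').
      by move=> _ [[w s] [_ /= Ds] <-].
    apply: measurable_funTS.
    by apply: measurable_fun_pair; [exact: measurable_snd|exact: measurable_fst].
  apply: (measurable_integral_on P measurableT mD ms).
  by move=> x; rewrite lee_fin sqr_ge0.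
apply: ge0_le_integral => //.
by move=> s _; apply: integral_ge0 => w _; rewrite lee_fin sqr_ge0.
Qed.

Section pairing.
Variable Y : T2 -> R.
Hypotheses (mY : measurable_fun setT Y) (Y2 : \int[P]_w (Y w ^+ 2)%:E < +oo).

Let mYg : measurable_fun (D `*` setT) (fun z => (Y z.2 * g z)%R).
Proof.
apply: measurable_funM => //; apply: measurable_funTS.
exact: measurableT_comp mY measurable_snd.
Qed.

Let Yg_fin : \int[m]_(s in D) \int[P]_w `|Y w * g (s, w)|%:E < +oo.
Proof.
have mYgn : measurable_fun (D `*` setT) (fun z : T1 * T2 => `|(Y z.2 * g z)%R|%:E).
  by apply/measurable_EFinP; exact: measurableT_comp.
rewrite (tonelli_on m P mD measurableT mYgn)//.
have mY2 : measurable_fun setT (fun w => (Y w ^+ 2)%:E).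
  by apply/measurable_EFinP; exact: measurable_funX.
have mG2 : measurable_fun setT (fun w => \int[m]_(s in D) (g (s, w) ^+ 2)%:E).
  exact: (measurable_integral_on m mD measurableT mg2' g2_ge0).
apply: (@le_lt_trans _ _ (\int[P]_w
    (tau%:E * (Y w ^+ 2)%:E + \int[m]_(s in D) (g (s, w) ^+ 2)%:E))).
  apply: ge0_le_integral => //.
  - by move=> w _; exact: integral_ge0.
  - exact: (measurable_integral_on m mD measurableT mYgn).
  - by apply: emeasurable_funD => //; exact: emeasurable_funM.
  - move=> w _; have mgw := measurable_section2 mD measurableT I mg (y := w).
    rewrite (_ : tau%:E * _ + _ =
        \int[m]_(s in D) ((Y w ^+ 2)%:E + (g (s, w) ^+ 2)%:E)); last first.
      rewrite ge0_integralD//; try (by move=> s _; rewrite lee_fin sqr_ge0).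
        by rewrite integral_cst// muleC -mDtau.
      by apply/measurable_EFinP; exact: measurable_funX.
    apply: ge0_le_integral => //.
    * exact: (measurable_section2 mD measurableT I mYgn).
    * by apply: emeasurable_funD => //; apply/measurable_EFinP; exact: measurable_funX.
    * by move=> s _; rewrite -EFinD lee_fin /= normM_le_sqr.
rewrite ge0_integralD//; try (by move=> w _; apply: integral_ge0 => s _; exact: g2_ge0).
- rewrite ge0_integralZl//; try (by move=> w _; rewrite lee_fin sqr_ge0).
    rewrite lte_add_pinfty//; last exact: le_lt_trans integral_sq_bound (ltry _).
    by rewrite lte_mul_pinfty ?lee_fin ?ltW.
  by rewrite lee_fin ltW.
- by move=> w _; apply: mule_ge0; rewrite lee_fin ?sqr_ge0// ltW.
- exact: emeasurable_funM.
Qed.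

Lemma pairing_integrable : {ae P, forall w,
  m.-integrable D (fun s => (Y w * g (s, w))%:E)}.
Proof.
have := @ae_integrable_on _ _ _ _ _ m P _ _ mD measurableT _ mYg Yg_fin.
by apply: filterS => w /(_ I).
Qed.

(** Fubini applies because |Y g| <= Y^2 + g^2, and both squares have finite
    integral over D and the probability space. *)
Lemma expectation_pairing : {ae P, forall w, m.-integrable D (fun s => (g (s, w))%:E)} ->
  \int[P]_w (Y w * W w)%:E = \int[m]_(s in D) \int[P]_w (Y w * g (s, w))%:E.
Proof.
move=> gi; rewrite (@fubini_on _ _ _ _ _ m P _ _ mD measurableT _ mYg Yg_fin).
apply: ae_eq_integral => //.
- by apply/measurable_EFinP; apply: measurable_funM => //; exact: measurable_path_integral.
- exact: (measurable_integral_EFin_on m mD measurableT mYg).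
- apply: filterS gi => w gw _.
  by rewrite EFinM /W EFin_Rintegral// -integralZl.
Qed.

End pairing.

Lemma path_integrable : {ae P, forall w, m.-integrable D (fun s => (g (s, w))%:E)}.
Proof.
have P1 : \int[P]_w ((fun=> 1%R : R) w ^+ 2)%:E < +oo.
  under eq_integral do rewrite expr1n.
  rewrite integral_cst// mul1e.
  exact: le_lt_trans (probability_le1 P measurableT) (ltry _).
have := @pairing_integrable (fun=> 1%R) (measurable_cst _) P1.
by apply: filterS => w; under eq_fun do rewrite mul1r.
Qed.

(** The Cauchy-Schwarz inequality, obtained by expanding the integral over D of
    (g - W / tau)^2, which is nonnegative. *)
Lemma path_integral_sq_le w : m.-integrable D (fun s => (g (s, w))%:E) ->
  (W w ^+ 2)%:E <= tau%:E * \int[m]_(s in D) (g (s, w) ^+ 2)%:E.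
Proof.
move=> gi; have mgw := measurable_section2 mD measurableT (I : setT w) mg.
have [Goo|] := eqVneq (\int[m]_(s in D) (g (s, w) ^+ 2)%:E) +oo.
  by rewrite Goo gt0_muley ?lte_fin// leey.
rewrite -ltey => Glt.
have g2i : m.-integrable D (EFin \o (fun s => (g (s, w) ^+ 2)%R)).
  apply/integrableP; split; first by apply/measurable_EFinP; exact: measurable_funX.
  by under eq_integral do rewrite /= ger0_norm ?sqr_ge0//.
pose a := (W w / tau)%R.
have ci : m.-integrable D (EFin \o cst (a ^+ 2)%R).
  apply/integrableP; split => //.
    by apply/measurable_EFinP; exact: measurable_cst.
  rewrite (_ : \int[m]_(x in D) _ = (`|a ^+ 2|%R)%:E * m D); last first.
    exact: (@integral_cst _ _ _ m D mD (`|a ^+ 2|%R)%:E).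
  by rewrite mDtau -EFinM ltry.
have a2i : m.-integrable D (EFin \o (fun s => 2 * a * g (s, w))%R).
  exact: (integrableZl mD (2 * a) gi).
have b2i : m.-integrable D (EFin \o (fun s => (g (s, w) ^+ 2 - 2 * a * g (s, w))%R)).
  rewrite (_ : EFin \o _ = (EFin \o (fun s => (g (s, w) ^+ 2)%R)) \-
    (EFin \o (fun s => (2 * a * g (s, w))%R)))//.
  exact: integrableB.
have : (0 <= \int[m]_(s in D) (g (s, w) ^+ 2 - 2 * a * g (s, w) + a ^+ 2))%R.
  apply: Rintegral_ge0 => s _.
  by rewrite (_ : _ + _ = (g (s, w) - a) ^+ 2)%R ?sqr_ge0//; ring.
rewrite RintegralD// RintegralB// RintegralZl// Rintegral_cst// [fine _](_ : _ = tau); last first.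
  by rewrite -[tau]/(fine tau%:E) -mDtau.
rewrite -/(W w) -EFin_Rintegral// -EFinM lee_fin => h.
have tn0 : tau != 0%R by rewrite gt_eqF.
have : (0 <= tau * (\int[m]_(x in D) g (x, w) ^+ 2 - 2 * a * W w + a ^+ 2 * tau))%R.
  by rewrite mulr_ge0// ltW.
by rewrite -subr_ge0; congr (_ <= _)%R; rewrite /a; field.
Qed.

Lemma path_integral_sq_fin : \int[P]_w (W w ^+ 2)%:E < +oo.
Proof.
apply: (@le_lt_trans _ _ (\int[P]_w (tau%:E * \int[m]_(s in D) (g (s, w) ^+ 2)%:E))).
  apply: ae_ge0_le_integral => //.
  - by move=> w _; rewrite lee_fin sqr_ge0.
  - by apply/measurable_EFinP; apply: measurable_funX; exact: measurable_path_integral.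
  - move=> w _; apply: mule_ge0; first by rewrite lee_fin ltW.
    by apply: integral_ge0 => s _; exact: g2_ge0.
  - apply: emeasurable_funM => //.
    exact: (measurable_integral_on m mD measurableT mg2' g2_ge0).
  - by apply: filterS path_integrable => w gi _; exact: path_integral_sq_le.
rewrite ge0_integralZl//.
- by rewrite lte_mul_pinfty ?lee_fin ?ltW// (le_lt_trans integral_sq_bound)// ltry.
- exact: (measurable_integral_on m mD measurableT mg2' g2_ge0).
- by move=> w _; apply: integral_ge0 => s _; exact: g2_ge0.
- by rewrite lee_fin ltW.
Qed.

(** Pairing first with W and then, for each s, with g(s) replaces both factors
    of W^2 by integrals over D. *)
Theorem second_moment_path_integral :
  \int[P]_w (W w ^+ 2)%:E =
  \int[m]_(s in D) \int[m]_(r in D) \int[P]_w (g (s, w) * g (r, w))%:E.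
Proof.
under eq_integral do rewrite expr2.
rewrite (expectation_pairing measurable_path_integral path_integral_sq_fin path_integrable).
apply: eq_integral => s; rewrite inE => Ds.
have ms : measurable_fun setT (fun w => g (s, w)).
  by have := measurable_section1 mD measurableT Ds mg; exact.
rewrite -(expectation_pairing ms _ path_integrable); last first.
  exact: le_lt_trans (gc Ds) (ltry _).
by apply: eq_integral => w _; rewrite mulrC.
Qed.

End second_moment.

(** * Expectation of a product of independent variables *)

Section independence.
Context d (Omega : measurableType d) (R : realType) (P : probability Omega R).
Variables X Y : Omega -> R.
Hypotheses (mX : measurable_fun setT X) (mY : measurable_fun setT Y).
Local Open Scope ereal_scope.

Lemma integrable_sqfin (Z : Omega -> R) : measurable_fun setT Z ->
  \int[P]_w (Z w ^+ 2)%:E < +oo -> P.-integrable setT (EFin \o Z).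
Proof.
move=> mZ Z2; apply: (@le_integrable _ _ _ P setT measurableT _
    (fun w => 1 + (Z w ^+ 2)%:E)).
- exact/measurable_EFinP.
- move=> w _ /=; rewrite lee_fin [leRHS]ger0_norm ?addr_ge0 ?sqr_ge0//.
  by have := normM_le_sqr 1 (Z w); rewrite mul1r expr1n.
- apply: integrableD => //.
    exact: (finite_measure_integrable_cst P 1).
  apply/integrableP; split.
    by apply/measurable_EFinP; exact: measurable_funX.
  by under eq_integral do rewrite /= ger0_norm ?sqr_ge0//.
Qed.

Lemma integrable_mul_sqfin : \int[P]_w (X w ^+ 2)%:E < +oo ->
  \int[P]_w (Y w ^+ 2)%:E < +oo ->
  P.-integrable setT (fun w => (X w * Y w)%:E).
Proof.
move=> X2 Y2; apply: (@le_integrable _ _ _ P setT measurableT _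
    (fun w => (X w ^+ 2)%:E + (Y w ^+ 2)%:E)).
- by apply/measurable_EFinP; exact: measurable_funM.
- move=> w _ /=; rewrite lee_fin [leRHS]ger0_norm ?addr_ge0 ?sqr_ge0//.
  exact: normM_le_sqr.
- apply: integrableD => //; apply/integrableP; split.
  + by apply/measurable_EFinP; exact: measurable_funX.
  + by under eq_integral do rewrite /= ger0_norm ?sqr_ge0//.
  + by apply/measurable_EFinP; exact: measurable_funX.
  + by under eq_integral do rewrite /= ger0_norm ?sqr_ge0//.
Qed.

Hypothesis indep : forall A B : set R, measurable A -> measurable B ->
  P (X @^-1` A `&` Y @^-1` B) = P (X @^-1` A) * P (Y @^-1` B).

(** Independence identifies the law of (X, Y) with the product of the laws of X
    and Y; the product then splits by Fubini. *)
Lemma expectation_mul_indep : \int[P]_w (X w ^+ 2)%:E < +oo ->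
  \int[P]_w (Y w ^+ 2)%:E < +oo ->
  \int[P]_w (X w * Y w)%:E = \int[P]_w (X w)%:E * \int[P]_w (Y w)%:E.
Proof.
move=> X2 Y2.
have Xi := integrable_sqfin mX X2; have Yi := integrable_sqfin mY Y2.
have XYi := integrable_mul_sqfin X2 Y2.
pose mfX : {mfun Omega >-> R} := HB.pack X (isMeasurableFun.Build _ _ _ _ X mX).
pose mfY : {mfun Omega >-> R} := HB.pack Y (isMeasurableFun.Build _ _ _ _ Y mY).
pose XY w := (X w, Y w).
have mXY : measurable_fun setT XY by exact: measurable_fun_pair.
pose mfXY : {mfun Omega >-> (R * R)%type} :=
  HB.pack XY (isMeasurableFun.Build _ _ _ _ XY mXY).
pose f (z : R * R) := (z.1 * z.2)%:E.
have mf : measurable_fun setT f.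
  apply/measurable_EFinP; apply: measurable_funM.
    exact: measurable_fst.
  exact: measurable_snd.
have prodE A : measurable A ->
    (distribution P mfX \x distribution P mfY) A = distribution P mfXY A.
  apply: product_measure_unique => B C mB mC.
  by rewrite /distribution /pushforward /= -indep.
rewrite -[LHS](integral_distribution (X := mfXY) mf)//.
rewrite (eq_measure_integral (distribution P mfX \x distribution P mfY)); last first.
  by move=> A mA _; exact/esym/prodE.
have fi : (distribution P mfX \x distribution P mfY).-integrable setT f.
  apply/integrableP; split => //.
  rewrite (eq_measure_integral (distribution P mfXY)); last first.
    by move=> A mA _; exact: prodE.
  rewrite ge0_integral_distribution//; last exact: measurableT_comp.
  by have /integrableP[] := XYi.
rewrite -(integral12_prod_meas1 fi) /fubini_F /f /=.
have Xd : \int[distribution P mfX]_x x%:E = \int[P]_w (X w)%:E.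
  exact: integral_distribution.
have Yd : \int[distribution P mfY]_x x%:E = \int[P]_w (Y w)%:E.
  exact: integral_distribution.
have Ydi : (distribution P mfY).-integrable setT EFin.
  apply/integrableP; split => //.
  rewrite ge0_integral_distribution//; last exact: measurableT_comp.
  by have /integrableP[] := Yi.
have Xdi : (distribution P mfX).-integrable setT EFin.
  apply/integrableP; split => //.
  rewrite ge0_integral_distribution//; last exact: measurableT_comp.
  by have /integrableP[] := Xi.
under eq_integral do under eq_integral do rewrite EFinM.
under eq_integral do rewrite integralZl// Yd.
have Yfin : \int[P]_w (Y w)%:E \is a fin_num by exact: integrable_fin_num.
by rewrite -(fineK Yfin) integralZr// Xd.
Qed.

End independence.

(** * Covariance of the noise *)

Section borel_vectors.
Context {R : realType}.

Lemma measurable_coord n (i : 'I_n) :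
  @measurable_fun _ _ (borel_cV R n) R setT (fun v : 'cV[R]_n => v i 0).
Proof.
apply: (measurability _ (RGenOpens.measurableE R)).
move=> _ [_ [a [b ->]] <-]; rewrite setTI; apply: sub_sigma_algebra.
apply: open_comp; last exact: itv_open.
by move=> v _; exact: coord_continuous.
Qed.

End borel_vectors.

Section noise_covariance.
Context d (Omega : measurableType d) (R : realType) (P : probability Omega R).
Context (m : nat) (F : R -> set (set Omega)) (M : R -> Omega -> 'cV[R]_m) (K S : 'M[R]_m).
Hypotheses (hF : filtration_usual P F) (hsq : square_integrable P M)
  (hmean : mean_zero P M) (had : adapted F M)
  (hind : increments_independent_of_past P F M)
  (hcov : covariance_matrix P M K) (hS : psd_sqrt K S).
Local Open Scope ereal_scope.

Lemma adapted_coord_measurable n (X : R -> Omega -> 'cV[R]_n) (t : R) i :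
  adapted F X -> (0 <= t)%R -> measurable_fun setT (fun w => X t w i 0%R).
Proof.
move=> aX t0 _ B mB; rewrite setTI.
apply: (filtration_measurable hF t0).
apply: (aX t t0 [set v | B (v i 0%R)]).
by have := measurable_coord i measurableT mB; rewrite setTI.
Qed.

Let mM (t : R) i : (0 <= t)%R -> measurable_fun setT (fun w => M t w i 0%R).
Proof. exact: adapted_coord_measurable. Qed.

Lemma noise_sqfin (t : R) i : (0 <= t)%R -> \int[P]_w (M t w i 0%R ^+ 2)%:E < +oo.
Proof.
move=> t0; apply: le_lt_trans (hsq t0); rewrite unlock.
apply: ge0_le_integral => //.
- by move=> w _; rewrite lee_fin sqr_ge0.
- by apply/measurable_EFinP; apply: measurable_funX; exact: mM.
- apply/measurable_EFinP; rewrite (_ : (fun w => _) = (fun w => \sum_i M t w i 0%R ^+ 2)%R).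
    by apply: measurable_sum => k; apply: measurable_funX; exact: mM.
  by apply/funext => w; rewrite /enorm sqr_sqrtr// sumr_ge0// => k _; exact: sqr_ge0.
- move=> w _; rewrite lee_fin /enorm sqr_sqrtr; last first.
    by apply: sumr_ge0 => k _; exact: sqr_ge0.
  by rewrite (bigD1 i)//= lerDl sumr_ge0// => k _; exact: sqr_ge0.
Qed.

(** M(s) is M(r) plus an increment which has mean zero and is independent of
    M(r), so that the increment does not contribute. *)
Let cov_le i j (r s : R) : (0 <= r)%R -> (r <= s)%R ->
  \int[P]_w (M r w i 0 * M s w j 0)%:E = (K i j * r)%:E.
Proof.
move=> r0 rs; have s0 := le_trans r0 rs.
pose X w := M r w i 0%R; pose Y w := (M s w j 0 - M r w j 0)%R.
have mX : measurable_fun setT X by exact: mM.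
have mY : measurable_fun setT Y by apply: measurable_funB; exact: mM.
have X2 := noise_sqfin i r0; have Mr2 := noise_sqfin j r0; have Ms2 := noise_sqfin j s0.
have XMr := integrable_mul_sqfin mX (mM j r0) X2 Mr2.
have XMs := integrable_mul_sqfin mX (mM j s0) X2 Ms2.
have Mri := integrable_sqfin (mM j r0) Mr2; have Msi := integrable_sqfin (mM j s0) Ms2.
have Y2 : \int[P]_w (Y w ^+ 2)%:E < +oo.
  apply: (@le_lt_trans _ _ (\int[P]_w
    (2%:E * (M s w j 0%R ^+ 2)%:E + 2%:E * (M r w j 0%R ^+ 2)%:E))).
    apply: ge0_le_integral => //.
    - by move=> w _; rewrite lee_fin sqr_ge0.
    - by apply/measurable_EFinP; exact: measurable_funX.
    - apply: emeasurable_funD; apply: emeasurable_funM => //;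
        by apply/measurable_EFinP; apply: measurable_funX; exact: mM.
    - move=> w _; rewrite -!EFinM -EFinD lee_fin /Y.
      by have := sqr_ge0 (M s w j 0 + M r w j 0)%R; nra.
  have m2 t (t0 : (0 <= t)%R) : measurable_fun setT (fun w => (M t w j 0%R ^+ 2)%:E).
    by apply/measurable_EFinP; apply: measurable_funX; exact: mM.
  rewrite ge0_integralD//; try (by move=> w _; rewrite -EFinM lee_fin mulr_ge0// sqr_ge0).
  - rewrite !ge0_integralZl//; try (by move=> w _; rewrite lee_fin sqr_ge0); try exact: m2.
    by rewrite lte_add_pinfty// lte_mul_pinfty.
  - by apply: emeasurable_funM => //; exact: m2.
  - by apply: emeasurable_funM => //; exact: m2.
have indep A B : measurable A -> measurable B ->
    P (X @^-1` A `&` Y @^-1` B) = P (X @^-1` A) * P (Y @^-1` B).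
  move=> mA mB.
  have cA : measurable ([set v | A (v i 0%R)] : set (borel_cV R m)).
    by have := measurable_coord i measurableT mA; rewrite setTI.
  have cB : measurable ([set v | B (v j 0%R)] : set (borel_cV R m)).
    by have := measurable_coord j measurableT mB; rewrite setTI.
  have sr0 : (0 <= s - r)%R by rewrite subr_ge0.
  have := hind r0 sr0 (had r0 cA) cB.
  rewrite [(r + _)%R]addrC subrK.
  suff -> : [set w | [set v : 'cV[R]_m | B (v j 0%R)] (M s w - M r w)%R] = Y @^-1` B by [].
  by apply/seteqP; split => w /=; rewrite /Y !mxE.
have EY : \int[P]_w (Y w)%:E = 0.
  under eq_integral do rewrite EFinB.
  rewrite integralB_EFin//.
  have := hmean s0 j; have := hmean r0 j; rewrite unlock => -> ->.
  by rewrite sube0.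
have EXY := expectation_mul_indep mX mY indep X2 Y2.
rewrite EY mule0 in EXY.
have XY := integrable_mul_sqfin mX mY X2 Y2.
transitivity (\int[P]_w ((M r w i 0 * M r w j 0)%:E + (X w * Y w)%:E)).
  by apply: eq_integral => w _; rewrite -EFinD; congr EFin; rewrite /X /Y; ring.
rewrite integralD_EFin// EXY adde0.
have := hcov r0 i j; rewrite unlock => <-.
by apply: eq_integral => w _; rewrite mxE big_ord1 !mxE.
Qed.

Lemma noise_covariance i j (r s : R) : (0 <= r)%R -> (0 <= s)%R ->
  \int[P]_w (M r w i 0 * M s w j 0)%:E = (\sum_l S i l * S j l * Num.min r s)%:E.
Proof.
move=> r0 s0; case: hS => St _ SS.
have KE a b : K a b = (\sum_l S a l * S b l)%R.
  by rewrite -SS mxE; apply: eq_bigr => l _; rewrite -{2}St mxE.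
rewrite -mulr_suml -KE; have [rs|/ltW sr] := leP r s; first exact: cov_le.
under eq_integral do rewrite mulrC.
rewrite cov_le//; congr (_ * _)%:E.
by rewrite !KE; apply: eq_bigr => l _; rewrite mulrC.
Qed.

End noise_covariance.

(** * Variation of constants *)

Section mild_solution.
Context d (Omega : measurableType d) (R : realType) (P : probability Omega R).
Context (F : R -> set (set Omega)) (m1 m2 : nat).
Variables (u : R -> Omega -> 'cV[R]_m1) (M : R -> Omega -> 'cV[R]_m2) (t : R).
Notation mu := (@lebesgue_measure R).

(** The noise part int_0^t H(t-s) dM(s) of y, integrated by parts, is
    H(0) M(t) + int_0^t dH(t-s) M(s) ds; dividing H(0) M(t) by t puts it under
    the time integral as well.  The integrand is represented by a jointly
    measurable g that agrees with it almost surely at each fixed time, with an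
    exceptional event depending on the time. *)
Definition mild_output (Hu : R -> 'rV[R]_m1) (H dH : R -> 'rV[R]_m2)
    (y : Omega -> R) : Prop :=
  exists g : measurableTypeR R * Omega -> R,
  [/\ @measurable_fun _ _ (measurableTypeR R * Omega)%type R
        (`[0, t] `*` setT) g,
      forall s, 0 <= s <= t -> {ae P, forall w,
        g (s, w) = (H 0 *m M t w) 0 0 / t + (dH (t - s) *m M s w) 0 0} &
      {ae P, forall w,
        [/\ mu.-integrable `[0, t] (fun s => (g (s, w))%:E),
            mu.-integrable `[0, t] (fun s => ((Hu (t - s) *m u s w) 0 0)%:E) &
            y w = \int[mu]_(s in `[0, t]) g (s, w) +
                  \int[mu]_(s in `[0, t]) (Hu (t - s) *m u s w) 0 0]}].

Lemma mild_outputB Hu1 H1 dH1 y1 Hu2 H2 dH2 y2 :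
  mild_output Hu1 H1 dH1 y1 -> mild_output Hu2 H2 dH2 y2 ->
  mild_output (fun s => Hu1 s - Hu2 s) (fun s => H1 s - H2 s)
    (fun s => dH1 s - dH2 s) (fun w => y1 w - y2 w).
Proof.
move=> [g1 [mg1 e1 a1]] [g2 [mg2 e2 a2]].
exists (fun z => g1 z - g2 z); split.
- exact: measurable_funB.
- move=> s st; apply: filterS2 (e1 s st) (e2 s st) => w -> ->.
  by rewrite !mulmxBl !mxE; ring.
- apply: filterS2 a1 a2 => w [i1 j1 ->] [i2 j2 ->].
  have uE s : ((Hu1 (t - s) - Hu2 (t - s)) *m u s w) 0 0 =
      (Hu1 (t - s) *m u s w) 0 0 - (Hu2 (t - s) *m u s w) 0 0.
    by rewrite mulmxBl !mxE.
  split.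
  + rewrite (_ : (fun s => _) = (fun s => (g1 (s, w))%:E) \- (fun s => (g2 (s, w))%:E))%E//.
    exact: integrableB.
  + rewrite (_ : (fun s => _) = (fun s => ((Hu1 (t - s)%R *m u s w) 0%R 0%R)%:E) \-
      (fun s => ((Hu2 (t - s)%R *m u s w) 0%R 0%R)%:E))%E; first exact: integrableB.
    by apply/funext => s /=; rewrite uE EFinB.
  + rewrite [X in _ = _ + X](_ : _ = \int[mu]_(s in `[0, t])
      ((Hu1 (t - s) *m u s w) 0 0 - (Hu2 (t - s) *m u s w) 0 0)); last first.
      by apply: eq_Rintegral => s _; exact: uE.
    by rewrite !RintegralB//; ring.
Qed.

Lemma joint_coord n (X : R -> Omega -> 'cV[R]_n) i : jointly_measurable X ->
  @measurable_fun _ _ (measurableTypeR R * Omega)%type R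
    (`[0, t] `*` setT) (fun z => X z.1 z.2 i 0).
Proof.
move=> jX.
have mX : @measurable_fun _ _ (measurableTypeR R * Omega)%type (borel_cV R n)
    (`[0, t] `*` setT) (fun z => X z.1 z.2).
  apply: (measurable_funS _ _ jX).
    apply: measurableX => //.
    rewrite (_ : [set t | 0 <= t] = [set` `[0, +oo[])//.
    by apply/seteqP; split => r /=; rewrite in_itv/= andbT.
  by move=> z /= [z1 _]; split => //; move: z1; rewrite in_itv/= => /andP[].
by have := measurableT_comp (measurable_coord i) mX.
Qed.

Section system.
Variables (n : nat) (A : 'M[R]_n) (B : 'M[R]_(n, m1)) (G : 'M[R]_(n, m2)).
Variables (x : R -> Omega -> 'cV[R]_n) (c : 'rV[R]_n).
Hypotheses (t0 : 0 < t) (hx : solves_sde P F A B G u M x).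
Hypothesis ju : jointly_measurable u.
Hypothesis ui : {ae P, forall w, forall k, mu.-integrable `[0, t]
  (fun s => (u s w k 0)%:E)}.

Let f i (s : R) w := (A *m x s w + B *m u s w) i 0.
Let drift i (s : R) w := \int[mu]_(r in `[0, s]) f i r w.
Let N i (s : R) w := x s w i 0 - drift i s w.
Let phi (s : R) : 'rV[R]_n := c *m expm ((t - s) *: A).

Let mf i : @measurable_fun _ _ (measurableTypeR R * Omega)%type R
    (`[0, t] `*` setT) (fun z => f i z.1 z.2).
Proof.
rewrite (_ : (fun z => _) = (fun z : measurableTypeR R * Omega =>
    \sum_j A i j * x z.1 z.2 j 0 + \sum_k B i k * u z.1 z.2 k 0)); last first.
  by apply/funext => z; rewrite /f !mxE.
apply: measurable_funD; apply: measurable_sum => j; apply: measurable_funM => //.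
  exact: joint_coord (sde_jointly_measurable hx).
exact: joint_coord ju.
Qed.

Let mdrift i : @measurable_fun _ _ (measurableTypeR R * Omega)%type R
    (`[0, t] `*` setT) (fun z => drift i z.1 z.2).
Proof.
(* The variable upper limit s becomes a condition on the integration variable. *)
pose Fi (z : measurableTypeR R * (measurableTypeR R * Omega)) :=
  if z.1 <= z.2.1 then f i z.1 z.2.2 else 0.
have mE : measurable (`[0, t] `*` setT : set (measurableTypeR R * Omega)).
  exact: measurableX.
have mFi : @measurable_fun _ _
    (measurableTypeR R * (measurableTypeR R * Omega)%type)%type R
    (`[0, t] `*` (`[0, t] `*` setT)) Fi.
  apply: measurable_fun_if; [exact: measurableX| | |exact: measurable_cst].
  - apply: measurable_fun_ler; apply: measurable_funTS.
      exact: measurable_fst.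
    exact: measurableT_comp measurable_fst measurable_snd.
  - apply: (@measurable_funS _ _ _ _ (`[0, t] `*` setT)).
    + exact: measurableX.
    + by move=> z [[z1 _] _].
    + have hg : @measurable_fun _ _ (measurableTypeR R * (measurableTypeR R * Omega)%type)%type
          (measurableTypeR R * Omega)%type (`[0, t] `*` setT) (fun z => (z.1, z.2.2)).
        apply: measurable_funTS; apply: measurable_fun_pair.
          exact: measurable_fst.
        exact: measurableT_comp measurable_snd measurable_snd.
      have := measurable_comp mE _ (mf i) hg; apply.
      by move=> _ [z [z1 _] <-].
have := measurable_Rintegral_on mu (measurable_itv `[0, t]) mE mFi.
apply: eq_measurable_fun => -[s w]; rewrite inE => -[/=]; rewrite in_itv/= => /andP[s0 st] _.
have sub : [set` `[0, t]] `&` [set` `[0, s]] = [set` `[0, s]].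
  apply/setIidPr => r /=; rewrite !in_itv /= => /andP[-> rs] /=.
  exact: le_trans rs st.
rewrite /drift -[in RHS]sub Rintegral_mkcondr; apply: eq_Rintegral => r.
rewrite inE/= in_itv/= => /andP[r0 _].
by rewrite patchE mem_setE in_itv/= r0.
Qed.

Let mN i : @measurable_fun _ _ (measurableTypeR R * Omega)%type R
    (`[0, t] `*` setT) (fun z => N i z.1 z.2).
Proof.
by apply: measurable_funB; [exact: joint_coord (sde_jointly_measurable hx)|exact: mdrift].
Qed.

Let dphi i (s : R) : is_derive s 1 (fun s => phi s 0 i) (- (phi s *m A) 0 i).
Proof.
rewrite /phi.
rewrite (_ : (fun s => _) = (fun s => \sum_j c 0 j * expm ((t - s) *: A) j i)); last first.
  by apply/funext => r; rewrite mxE.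
rewrite (_ : - _ = \sum_j (c 0 j * - (expm ((t - s) *: A) *m A) j i +
    expm ((t - s) *: A) j i * 0)); last first.
  rewrite -mulmxA mxE -sumrN; apply: eq_bigr => j _.
  by rewrite mulr0 addr0 mulrN.
apply: (is_derive_sum1 (df := fun j s => c 0 j * - (expm ((t - s) *: A) *m A) j i +
    expm ((t - s) *: A) j i * 0)) => j.
exact: is_deriveM1 (is_derive_cst1 _ _) (is_derive_reflect (is_derive_expm A (t - s) j i)).
Qed.

Let cphi i : continuous (fun s => phi s 0 i).
Proof. by move=> s; exact: is_derive_cont (dphi i s). Qed.

Let cphiM q (Q : 'M[R]_(n, q)) k : continuous (fun s => (phi s *m Q) 0 k).
Proof.
rewrite (_ : (fun s => _) = (fun s => \sum_i phi s 0 i * Q i k)); last first.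
  by apply/funext => s; rewrite mxE.
move=> s; apply: cvg_big => [|i _]; first exact: add_continuous.
by apply: cvgM; [exact: cphi|exact: cvg_cst].
Qed.

Let g (z : measurableTypeR R * Omega) : R :=
  (\sum_i c 0 i * N i t z.2) / t + \sum_i (phi z.1 *m A) 0 i * N i z.1 z.2.

Let mg : @measurable_fun _ _ (measurableTypeR R * Omega)%type R
    (`[0, t] `*` setT) g.
Proof.
have It : [set` `[0, t]] t by rewrite /= in_itv/= lexx ltW.
apply: measurable_funD.
  apply: measurable_funM => //; apply: measurable_sum => i; apply: measurable_funM => //.
  apply: measurable_funTS.
  have := measurable_section1 (measurable_itv `[0, t]) measurableT It (mN i).
  by move=> mNt; exact: measurableT_comp mNt measurable_snd.
apply: measurable_sum => i; apply: measurable_funM => //.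
apply: measurable_funTS.
have mh : measurable_fun setT (fun s : measurableTypeR R => (phi s *m A) 0 i).
  by apply: continuous_measurable_fun; exact: cphiM.
exact: measurableT_comp mh measurable_fst.
Qed.

Let noise_identified (s : R) : 0 <= s -> {ae P, forall w, forall i,
  N i s w = (G *m M s w) i 0}.
Proof.
move=> s0; have := sde_equation hx s0; apply: filterS => w e i.
by rewrite /N e !mxE /drift /f addrAC addrC; ring.
Qed.

(** Integrating phi_i against the drift rate f_i by parts, with
    phi' = - phi A, and summing over i gives
      int phi (A x + B u) = c (drift at t) + int phi A drift,
    hence c x(t) = c N(t) + int phi A N + int phi B u, a pathwise identity. *)
Lemma mild_output_sde : mild_output
  (fun s => c *m expm (s *: A) *m B) (fun s => c *m expm (s *: A) *m G)
  (fun s => c *m expm (s *: A) *m A *m G) (fun w => (c *m x t w) 0 0).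
Proof.
exists g; split; first exact: mg.
  move=> s /andP[s0 st].
  apply: filterS2 (noise_identified s0) (noise_identified (ltW t0)) => w es et.
  rewrite /g/=; congr (_ / _ + _).
  - by rewrite expm_0 mulmx1 -mulmxA mxE; apply: eq_bigr => i _; rewrite et.
  - by rewrite -mulmxA mxE; apply: eq_bigr => i _; rewrite es.
have fi := sde_integrable hx (ltW t0).
apply: filterS2 fi ui => w fi ui'.
pose a1 s := \sum_i phi s 0 i * f i s w.
pose a2 s := \sum_k (phi s *m B) 0 k * u s w k 0.
pose a3 s := \sum_i (phi s *m A) 0 i * drift i s w.
have a2E s : a2 s = (c *m expm ((t - s) *: A) *m B *m u s w) 0 0.
  by rewrite /a2 mxE.
pose sumI := @Rintegral_sum R _ (measurableTypeR R) mu.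
have [i1 e1] := sumI _ n (fun i s => phi s 0 i * f i s w) (measurable_itv `[0, t])
  (fun i => integrable_cont_mul (continuous_subspaceT (@cphi i)) (fi i)).
have [i2 e2] := sumI _ m1 (fun k s => (phi s *m B) 0 k * u s w k 0) (measurable_itv `[0, t])
  (fun k => integrable_cont_mul (continuous_subspaceT (@cphiM _ B k)) (ui' k)).
have di i : mu.-integrable `[0, t] (EFin \o (fun s => (phi s *m A) 0 i * drift i s w)).
  apply: continuous_compact_integrable; first exact: segment_compact.
  have cw := parameterized_integral_continuous (ltW t0) (fi i).
  move=> s; apply: cvgM; last exact: cw.
  by apply: continuous_subspaceT; exact: cphiM.
have [i3 e3] := sumI _ n (fun i s => (phi s *m A) 0 i * drift i s w)
  (measurable_itv `[0, t]) di.
have e13 : \int[mu]_(s in `[0, t]) a1 s =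
    \sum_i c 0 i * drift i t w + \int[mu]_(s in `[0, t]) a3 s.
  rewrite e1 e3 -big_split/=; apply: eq_bigr => i _.
  have cd : continuous (fun s => - (phi s *m A) 0 i).
    by move=> s; apply: cvgN; exact: cphiM.
  rewrite (ibp_primitive (ltW t0) (dphi i) cd (fi i)).
  rewrite {1}/phi subrr expm_0 mulmx1; congr (_ + _).
  rewrite (_ : \int[mu]_(r in `[0, t]) (- _ * _) =
      -1 * \int[mu]_(r in `[0, t]) ((phi r *m A) 0 i * drift i r w)).
    by rewrite mulN1r opprK.
  rewrite -(@RintegralZl _ (measurableTypeR R) R mu _ _ (-1) (measurable_itv `[0, t]) (di i)).
  by apply: eq_Rintegral => s _; rewrite mulN1r mulNr.
pose b (s : R) := (\sum_i c 0 i * N i t w) / t.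
have gE s : g (s, w) = b s + (a1 s - a2 s - a3 s).
  rewrite /g/=; congr (_ + _).
  have -> : a1 s = \sum_i (phi s *m A) 0 i * x s w i 0 + a2 s.
    transitivity ((phi s *m (A *m x s w + B *m u s w)) 0 0).
      by rewrite mxE.
    by rewrite mulmxDr !mulmxA mxE !mxE.
  rewrite addrK /a3 -sumrB; apply: eq_bigr => i _.
  by rewrite /N; ring.
have ib : mu.-integrable `[0, t] (EFin \o b).
  by apply: integrable_cont => s _; exact: cvg_cst.
have i12 : mu.-integrable `[0, t] (EFin \o (fun s => a1 s - a2 s)).
  rewrite (_ : _ \o _ = (EFin \o a1) \- (EFin \o a2))%E//; exact: integrableB.
have i123 : mu.-integrable `[0, t] (EFin \o (fun s => a1 s - a2 s - a3 s)).
  rewrite (_ : _ \o _ = (EFin \o (fun s => a1 s - a2 s)%R) \- (EFin \o a3))%E//.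
  exact: integrableB.
split.
- rewrite (_ : (fun s => _) = (EFin \o b) \+
    (EFin \o (fun s => a1 s - a2 s - a3 s)%R))%E; first exact: integrableD.
  by apply/funext => s; rewrite gE EFinD.
- rewrite (_ : (fun s => _) = EFin \o a2)//.
  by apply/funext => s; rewrite -a2E.
- rewrite [X in _ = _ + X](_ : _ = \int[mu]_(s in `[0, t]) a2 s); last first.
    by apply: eq_Rintegral => s _; rewrite -a2E.
  rewrite [X in _ = X + _](_ : _ =
      \int[mu]_(s in `[0, t]) (b s + (a1 s - a2 s - a3 s))); last first.
    by apply: eq_Rintegral => s _; rewrite gE.
  rewrite RintegralD// RintegralB// RintegralB// e13.
  rewrite /b Rintegral_cst//= lebesgue_measure_itv/= lte_fin t0/= subr0.
  rewrite divfK ?gt_eqF//.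
  rewrite (_ : \sum_i c 0 i * N i t w =
      (c *m x t w) 0 0 - \sum_i c 0 i * drift i t w); first by ring.
  by rewrite mxE -sumrB; apply: eq_bigr => i _; rewrite /N; ring.
Qed.

End system.
End mild_solution.

(** * Pointwise estimates *)

Section norms.
Context {R : realType}.

Lemma enorm_sqr n (v : 'cV[R]_n) : enorm v ^+ 2 = \sum_i v i 0 ^+ 2.
Proof. by rewrite sqr_sqrtr// sumr_ge0// => i _; exact: sqr_ge0. Qed.

Lemma frobenius_sqr m n (A : 'M[R]_(m, n)) : frobenius A ^+ 2 = \sum_i \sum_j A i j ^+ 2.
Proof.
by rewrite sqr_sqrtr// sumr_ge0// => i _; apply: sumr_ge0 => j _; exact: sqr_ge0.
Qed.

Lemma amgm (l a b : R) : 0 < l -> a * b <= l / 2 * a ^+ 2 + (2 * l)^-1 * b ^+ 2.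
Proof.
move=> l0; have ln0 : l != 0 by rewrite gt_eqF.
rewrite -subr_ge0 (_ : _ - _ = (2 * l)^-1 * (l * a - b) ^+ 2); last by field.
by rewrite mulr_ge0 ?sqr_ge0// invr_ge0 mulr_ge0// ltW.
Qed.

(** The minimum over l of l / 2 * a + b / (2 l) is sqrt a * sqrt b; with e added
    to both square roots the minimiser l exists even when a or b is zero, and
    e tends to zero. *)
Lemma le_sqrt_of_amgm (a b x y : R) : 0 <= a -> 0 <= b ->
  (forall l, 0 < l -> x <= l / 2 * a + (2 * l)^-1 * b + y) ->
  x <= Num.sqrt a * Num.sqrt b + y.
Proof.
move=> a0 b0 H; set sa := Num.sqrt a; set sb := Num.sqrt b.
have sa0 : 0 <= sa by exact: sqrtr_ge0.
have sb0 : 0 <= sb by exact: sqrtr_ge0.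
have aE : a = sa ^+ 2 by rewrite sqr_sqrtr.
have bE : b = sb ^+ 2 by rewrite sqr_sqrtr.
have key e : 0 < e -> x <= (sa + e) * (sb + e) + y.
  move=> e0; pose p := sa + e; pose q := sb + e.
  have p0 : 0 < p by rewrite ltr_wpDl.
  have q0 : 0 < q by rewrite ltr_wpDl.
  have pn0 : p != 0 by rewrite gt_eqF.
  have qn0 : q != 0 by rewrite gt_eqF.
  rewrite (le_trans (H (q / p) _)) ?divr_gt0// lerD2r.
  have -> : p * q = q / p / 2 * p ^+ 2 + (2 * (q / p))^-1 * q ^+ 2.
    by field; rewrite pn0 qn0.
  rewrite lerD// ler_wpM2l//.
  - by rewrite divr_ge0// ltW// divr_gt0.
  - by rewrite aE ler_sqr ?nnegrE ?(ltW p0)// lerDl ltW.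
  - by rewrite invr_ge0 mulr_ge0// ltW// divr_gt0.
  - by rewrite bE ler_sqr ?nnegrE ?(ltW q0)// lerDl ltW.
apply/ler_addgt0Pr => e e0.
pose k := sa + sb + 1.
have k1 : 1 <= k by rewrite lerDr addr_ge0.
have k0 : 0 < k by rewrite (lt_le_trans ltr01).
(* d <= 1 absorbs the quadratic term in d. *)
pose d := Num.min 1 (e / k).
have d0 : 0 < d by rewrite lt_min ltr01 divr_gt0.
have d1 : d <= 1 by rewrite ge_min lexx.
have dk : d * k <= e by rewrite -ler_pdivlMr// ge_min lexx orbT.
apply: (le_trans (key d d0)).
rewrite /k in dk; nra.
Qed.

Notation mu := (@lebesgue_measure R).

(** Pairing Y with itself gives |Y|^2 = Y . V + int Y . (Hu v).  Every product
    of coordinates is estimated by [amgm] applied to Y / |Y|, so both terms are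
    at most |Y| times a quantity that is linear in the squared norms. *)
Lemma norm_bound p m (Hu : R -> 'M[R]_(p, m)) (v : R -> 'cV[R]_m) (Y V : 'cV[R]_p)
    (t l1 l2 : R) : 0 < l1 -> 0 < l2 ->
  (forall i k, continuous (fun s => Hu s i k)) ->
  mu.-integrable `[0, t] (fun s => (enorm (v s) ^+ 2)%:E) ->
  (forall i, mu.-integrable `[0, t] (fun s => ((Hu (t - s) *m v s) i 0)%:E)) ->
  (forall i, Y i 0 = V i 0 + \int[mu]_(s in `[0, t]) (Hu (t - s) *m v s) i 0) ->
  enorm Y <= l1 / 2 + (2 * l1)^-1 * (\sum_i V i 0 ^+ 2) +
    (l2 / 2 * \int[mu]_(s in `[0, t]) frobenius (Hu (t - s)) ^+ 2 +
     (2 * l2)^-1 * \int[mu]_(s in `[0, t]) enorm (v s) ^+ 2).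
Proof.
move=> l10 l20 cH vi Hvi YE.
have cf : continuous (fun s => frobenius (Hu (t - s)) ^+ 2).
  rewrite (_ : (fun s => _) = (fun s => \sum_i \sum_k Hu (t - s) i k ^+ 2)); last first.
    by apply/funext => s; rewrite frobenius_sqr.
  move=> s; apply: cvg_big => [|i _]; first exact: add_continuous.
  apply: cvg_big => [|k _]; first exact: add_continuous.
  have cr : Hu (t - x) i k @[x --> s] --> Hu (t - s) i k.
    apply: (@continuous_comp _ _ _ (fun s => t - s) (fun s => Hu s i k)); last exact: cH.
    exact: is_derive_cont (is_deriveB1 (is_derive_cst1 t s) (is_derive_id1 s)).
  by apply: cvgM.
have fi : mu.-integrable `[0, t] (EFin \o (fun s => frobenius (Hu (t - s)) ^+ 2)).
  by apply: integrable_cont => s _; exact: cf.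
set f2 := \int[mu]_(s in _) frobenius _ ^+ 2.
set v2 := \int[mu]_(s in _) enorm _ ^+ 2.
have f20 : 0 <= f2 by apply: Rintegral_ge0 => s _; exact: sqr_ge0.
have v20 : 0 <= v2 by apply: Rintegral_ge0 => s _; exact: sqr_ge0.
have i2l (l : R) : 0 < l -> 0 <= (2 * l)^-1 by move=> l0; rewrite invr_ge0 mulr_ge0// ltW.
have := sqrtr_ge0 (\sum_i Y i 0 ^+ 2); rewrite -/(enorm Y) le_eqVlt => /predU1P[<-|n0].
  rewrite !addr_ge0// ?mulr_ge0 ?i2l// ?divr_ge0// ?(ltW l10) ?(ltW l20)//.
  by apply: sumr_ge0 => i _; exact: sqr_ge0.
set n := enorm Y in n0 *; have nn0 : n != 0 by rewrite gt_eqF.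
rewrite -(ler_pM2l n0) -expr2 {1}/n enorm_sqr.
have -> : \sum_i Y i 0 ^+ 2 = \sum_i Y i 0 * V i 0 +
    \sum_i \int[mu]_(s in `[0, t]) (Y i 0 * (Hu (t - s) *m v s) i 0).
  rewrite -big_split/=; apply: eq_bigr => i _.
  rewrite (@RintegralZl _ (measurableTypeR R) R mu _ _ (Y i 0) (measurable_itv _) (Hvi i)).
  by rewrite expr2 {2}YE mulrDr.
rewrite mulrDr lerD//.
  have -> : n * (l1 / 2 + (2 * l1)^-1 * \sum_i V i 0 ^+ 2) =
      \sum_i n * (l1 / 2 * (Y i 0 / n) ^+ 2 + (2 * l1)^-1 * V i 0 ^+ 2).
    rewrite -mulr_sumr big_split/= -!mulr_sumr; congr (_ * (_ + _)).
    under eq_bigr do rewrite expr_div_n.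
    by rewrite -mulr_suml -enorm_sqr -/n divff ?mulr1// expf_neq0.
  apply: ler_sum => i _; rewrite -{1}[Y i 0](divfK nn0) mulrAC mulrC ler_pM2l//.
  exact: amgm.
have Zi i : mu.-integrable `[0, t] (EFin \o (fun s => Y i 0 * (Hu (t - s) *m v s) i 0)).
  exact: (@integrableZl _ (measurableTypeR R) R mu _ (measurable_itv _) (Y i 0) _ (Hvi i)).
have [Si <-] := @Rintegral_sum R _ (measurableTypeR R) mu _ _ _ (measurable_itv `[0, t]) Zi.
have fl : mu.-integrable `[0, t] (EFin \o (fun s => l2 / 2 * frobenius (Hu (t - s)) ^+ 2)).
  exact: (@integrableZl _ (measurableTypeR R) R mu _ (measurable_itv _) (l2 / 2) _ fi).
have vl : mu.-integrable `[0, t] (EFin \o (fun s => (2 * l2)^-1 * enorm (v s) ^+ 2)).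
  exact: (@integrableZl _ (measurableTypeR R) R mu _ (measurable_itv _) (2 * l2)^-1 _ vi).
have fvi : mu.-integrable `[0, t] (EFin \o (fun s =>
    l2 / 2 * frobenius (Hu (t - s)) ^+ 2 + (2 * l2)^-1 * enorm (v s) ^+ 2)).
  rewrite (_ : _ \o _ = (EFin \o (fun s => l2 / 2 * frobenius (Hu (t - s)) ^+ 2)%R) \+
    (EFin \o (fun s => (2 * l2)^-1 * enorm (v s) ^+ 2)%R))%E//; exact: integrableD.
have -> : n * (l2 / 2 * f2 + (2 * l2)^-1 * v2) = \int[mu]_(s in `[0, t])
    (n * (l2 / 2 * frobenius (Hu (t - s)) ^+ 2 + (2 * l2)^-1 * enorm (v s) ^+ 2)).
  rewrite (@RintegralZl _ (measurableTypeR R) R mu _ _ n (measurable_itv _) fvi).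
  rewrite (@RintegralD _ (measurableTypeR R) R mu _ _ _ (measurable_itv _) fl vl).
  rewrite (@RintegralZl _ (measurableTypeR R) R mu _ _ (l2 / 2) (measurable_itv _) fi).
  by rewrite (@RintegralZl _ (measurableTypeR R) R mu _ _ (2 * l2)^-1 (measurable_itv _) vi).
apply: le_Rintegral => //.
  exact: (@integrableZl _ (measurableTypeR R) R mu _ (measurable_itv _) n _ fvi).
move=> s _; set H := Hu (t - s).
have -> : \sum_i Y i 0 * (H *m v s) i 0 = \sum_i \sum_k n * (H i k * (Y i 0 / n * v s k 0)).
  apply: eq_bigr => i _; rewrite mxE mulr_sumr; apply: eq_bigr => k _.
  by field.
have -> : n * (l2 / 2 * frobenius H ^+ 2 + (2 * l2)^-1 * enorm (v s) ^+ 2) =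
   \sum_i \sum_k n * (l2 / 2 * H i k ^+ 2 + (2 * l2)^-1 * (Y i 0 / n * v s k 0) ^+ 2).
  under [RHS]eq_bigr do rewrite -mulr_sumr big_split/= -!mulr_sumr.
  rewrite -mulr_sumr big_split/= -!mulr_sumr -frobenius_sqr; congr (_ * (_ + _ * _)).
  under [RHS]eq_bigr do under eq_bigr do rewrite exprMn expr_div_n.
  under [RHS]eq_bigr do rewrite -mulr_sumr -enorm_sqr.
  by rewrite -!mulr_suml -enorm_sqr -/n divff ?mul1r// expf_neq0.
by apply: ler_sum => i _; apply: ler_sum => k _; rewrite ler_pM2l//; exact: amgm.
Qed.

End norms.

(** * Variance of the noise part *)

Section noise_variance.
Context d (Omega : measurableType d) (R : realType) (P : probability Omega R).
Context (m : nat) (F : R -> set (set Omega)) (M : R -> Omega -> 'cV[R]_m) (K S : 'M[R]_m).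
Hypotheses (hF : filtration_usual P F) (hsq : square_integrable P M)
  (hmean : mean_zero P M) (had : adapted F M)
  (hind : increments_independent_of_past P F M)
  (hcov : covariance_matrix P M K) (hS : psd_sqrt K S).
Notation mu := (@lebesgue_measure R).

Lemma noise_linear_covariance (p q : 'rV[R]_m) (r s : R) : 0 <= r -> 0 <= s ->
  P.-integrable setT (EFin \o (fun w => (p *m M r w) 0 0 * (q *m M s w) 0 0)) /\
  \int[P]_w ((p *m M r w) 0 0 * (q *m M s w) 0 0) =
    \sum_l (p *m S) 0 l * (q *m S) 0 l * Num.min r s.
Proof.
move=> r0 s0.
have iMM k k' : P.-integrable setT (EFin \o (fun w => M r w k 0 * M s w k' 0)).
  exact: (integrable_mul_sqfin (adapted_coord_measurable hF k had r0)
    (adapted_coord_measurable hF k' had s0) (noise_sqfin hF hsq had k r0)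
    (noise_sqfin hF hsq had k' s0)).
have iZ k k' : P.-integrable setT
    (EFin \o (fun w => p 0 k * q 0 k' * (M r w k 0 * M s w k' 0))).
  exact: (integrableZl measurableT (p 0 k * q 0 k') (iMM k k')).
have iS k := Rintegral_sum measurableT (iZ k).
have [iSS eSS] := Rintegral_sum measurableT (fun k => (iS k).1).
rewrite (_ : (fun w => (p *m M r w) 0 0 * (q *m M s w) 0 0) =
    (fun w => \sum_k \sum_k' p 0 k * q 0 k' * (M r w k 0 * M s w k' 0))); last first.
  apply/funext => w; rewrite !mxE big_distrlr/=; apply: eq_bigr => k _.
  by apply: eq_bigr => k' _; ring.
split => //; rewrite eSS.
transitivity (\sum_k \sum_k' \sum_l p 0 k * q 0 k' * (S k l * S k' l * Num.min r s)).
  apply: eq_bigr => k _; rewrite (iS k).2; apply: eq_bigr => k' _.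
  rewrite RintegralZl// /Rintegral.
  rewrite (noise_covariance hF hsq hmean had hind hcov hS)//= mulr_sumr.
  by apply: eq_bigr => l _.
rewrite [RHS](_ : _ = \sum_l \sum_k \sum_k'
    p 0 k * q 0 k' * (S k l * S k' l * Num.min r s)); last first.
  apply: eq_bigr => l _; rewrite !mxE big_distrlr/= mulr_suml.
  apply: eq_bigr => k _; rewrite mulr_suml; apply: eq_bigr => k' _; ring.
rewrite [RHS]exchange_big/=; apply: eq_bigr => k _.
by rewrite exchange_big.
Qed.

Section path.
Variables (t : R) (H dH : R -> 'rV[R]_m) (g : measurableTypeR R * Omega -> R).
Hypotheses (t0 : 0 < t)
  (HdH : forall k (s : R), is_derive s 1 (fun s => H s 0 k) (dH s 0 k))
  (cdH : forall k, continuous (fun s => dH s 0 k))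
  (mg : @measurable_fun _ _ (measurableTypeR R * Omega)%type R (`[0, t] `*` setT) g)
  (gE : forall s, 0 <= s <= t -> {ae P, forall w,
        g (s, w) = (H 0 *m M t w) 0 0 / t + (dH (t - s) *m M s w) 0 0}).

Let e l s := (H (t - s) *m S) 0 l.
Let h l s := (dH (t - s) *m S) 0 l.

Let dHS l (s : R) : is_derive s 1 (fun s => (H s *m S) 0 l) ((dH s *m S) 0 l).
Proof.
rewrite (_ : (fun s => _) = (fun s => \sum_k S k l * H s 0 k)); last first.
  by apply/funext => x; rewrite mxE; apply: eq_bigr => k _; rewrite mulrC.
rewrite (_ : _ 0 l = \sum_k (S k l * dH s 0 k + H s 0 k * 0)); last first.
  by rewrite mxE; apply: eq_bigr => k _; rewrite mulr0 addr0 mulrC.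
apply: (is_derive_sum1 (df := fun k s => S k l * dH s 0 k + H s 0 k * 0)) => k.
exact: is_deriveM1 (is_derive_cst1 _ _) (HdH k s).
Qed.

Let de l (s : R) : is_derive s 1 (e l) (- h l s).
Proof. exact: is_derive_reflect (dHS l (t - s)). Qed.

Let ch l : continuous (h l).
Proof.
rewrite (_ : h l = (fun s => \sum_k dH (t - s) 0 k * S k l)); last first.
  by apply/funext => s; rewrite /h mxE.
move=> s; apply: cvg_big => [|k _]; first exact: add_continuous.
apply: cvgM; last exact: cvg_cst.
apply: (@continuous_comp _ _ _ (fun s => t - s) (fun s => dH s 0 k)); last exact: cdH.
exact: is_derive_cont (is_deriveB1 (is_derive_cst1 t s) (is_derive_id1 s)).
Qed.

(** The product of two values of g is a sum of four products of linear
    functionals of M; as the covariance of M is S S^T min(r, s), each is a sum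
    over the columns l of S, and the four terms for one l form a scalar
    kernel. *)
Lemma path_covariance (s r : R) : 0 <= s <= t -> 0 <= r <= t ->
  (\int[P]_w (g (s, w) * g (r, w))%:E = (\sum_l noise_kernel t (e l) (h l) s r)%:E)%E.
Proof.
move=> st rt; have /andP[s0 st'] := st; have /andP[r0 rt'] := rt.
have tn0 : t != 0 by rewrite gt_eqF.
have tt := ltW t0.
(* g(s) is Z p t + Z (dH (t - s)) s. *)
pose p := t^-1 *: H 0; pose Z (q : 'rV[R]_m) (s : R) w := (q *m M s w) 0 0.
pose qs := dH (t - s); pose qr := dH (t - r).
have mgs x : 0 <= x <= t -> measurable_fun setT (fun w => g (x, w)).
  move=> xt; have Ix : [set` `[0, t]] x by rewrite /= in_itv.
  by have := measurable_section1 (measurable_itv `[0, t]) measurableT Ix mg; exact.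
have scaleE q (Q : 'M[R]_(m, q)) j : (p *m Q) 0 j = (H 0 *m Q) 0 j / t.
  by rewrite /p -scalemxAl [LHS]mxE mulrC.
have Zp w : Z p t w = (H 0 *m M t w) 0 0 / t by exact: scaleE.
pose f w := Z p t w * Z p t w + Z p t w * Z qr r w + (Z qs s w * Z p t w + Z qs s w * Z qr r w).
have [i1 e1] := noise_linear_covariance p p tt tt.
have [i2 e2] := noise_linear_covariance p qr tt r0.
have [i3 e3] := noise_linear_covariance qs p s0 tt.
have [i4 e4] := noise_linear_covariance qs qr s0 r0.
have i12 : P.-integrable setT (EFin \o (fun w => Z p t w * Z p t w + Z p t w * Z qr r w)).
  exact: (integrableD measurableT i1 i2).
have i34 : P.-integrable setT (EFin \o (fun w => Z qs s w * Z p t w + Z qs s w * Z qr r w)).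
  exact: (integrableD measurableT i3 i4).
have fi : P.-integrable setT (EFin \o f) by exact: (integrableD measurableT i12 i34).
transitivity (\int[P]_w (f w)%:E)%E.
  apply: ae_eq_integral => //.
  - by apply/measurable_EFinP; apply: measurable_funM; exact: mgs.
  - by have /integrableP[] := fi.
  - apply: filterS2 (gE st) (gE rt) => w -> -> _; congr EFin.
    by rewrite /f Zp /Z /qs /qr; ring.
rewrite -EFin_Rintegral//; congr EFin; rewrite /f.
rewrite RintegralD// RintegralD// RintegralD// /Z e1 e2 e3 e4.
rewrite -!big_split/=; apply: eq_bigr => l _.
rewrite /noise_kernel minxx (min_r rt') (min_l st') /e /h scaleE subrr.
by rewrite -/qs -/qr; field.
Qed.

Lemma noise_variance :
  (\int[P]_w ((\int[mu]_(s in `[0%R, t]) g (s, w)) ^+ 2)%R%:E =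
   (\int[mu]_(s in `[0%R, t]) \sum_l (H s *m S) 0%R l ^+ 2)%R%:E)%E.
Proof.
pose k s := \sum_l noise_kernel t (e l) (h l) s s.
have ck : continuous k.
  move=> s; apply: cvg_big => [|l _]; first exact: add_continuous.
  have c1 a : (fun s => a * h l s * s / t) x @[x --> s] --> a * h l s * s / t.
    apply: cvgM; last exact: cvg_cst.
    by apply: cvgM; [apply: cvgM; [exact: cvg_cst|exact: ch]|exact: cvg_id].
  apply: cvgD.
    by apply: cvgD; [apply: cvgD; [exact: cvg_cst|exact: c1]|exact: c1].
  under eq_fun do rewrite minxx.
  rewrite minxx; apply: cvgM; last exact: cvg_id.
  by apply: cvgM; exact: ch.
(* The second moments of g are bounded on [0, t] by the maximum of k. *)
have [c0 _ kc] := EVT_max (ltW t0) (continuous_subspaceT ck).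
have gc s : [set` `[0, t]] s -> (\int[P]_w (g (s, w) ^+ 2)%:E <= (k c0)%:E)%E.
  move=> /= ts; under eq_integral do rewrite expr2.
  by rewrite path_covariance -?in_itv// lee_fin; exact: kc.
have muD : mu [set` `[0, t]] = t%:E.
  by rewrite lebesgue_measure_itv/= lte_fin t0 -EFinD subr0.
rewrite (@second_moment_path_integral _ _ (measurableTypeR R) Omega R mu P _ t (k c0) g
  (measurable_itv `[0, t]) muD t0 mg gc).
rewrite (_ : integral _ _ _ = (\int[mu]_(s in `[0%R, t]) \int[mu]_(r in `[0%R, t])
     (\sum_l noise_kernel t (e l) (h l) s r)%:E)%E); last first.
  apply: eq_integral => s; rewrite inE/= in_itv/= => st.
  apply: eq_integral => r; rewrite inE/= in_itv/= => rt.
  exact: path_covariance.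
rewrite (noise_kernel_integral t0 de ch); congr EFin.
apply: (@Rintegral_reflect R (fun s => \sum_l (H s *m S) 0 l ^+ 2) t (ltW t0)).
move=> s; apply: cvg_big => [|l _]; first exact: add_continuous.
by apply: cvgM; exact: is_derive_cont (dHS l s).
Qed.

End path.
End noise_variance.

(** * Bound on the output at a fixed time *)

Section impulse_response.
Context {R : realType} (p n m : nat) (C : 'M[R]_(p, n)) (A : 'M[R]_n) (G : 'M[R]_(n, m)).

Lemma is_derive_impulse i k (s : R) :
  is_derive s 1 (fun s => (C *m expm (s *: A) *m G) i k)
    ((C *m expm (s *: A) *m A *m G) i k).
Proof.
have E (Q : 'M[R]_n) : (C *m Q *m G) i k = \sum_j \sum_l (C i l * G j k) * Q l j.
  rewrite mxE; apply: eq_bigr => j _; rewrite mxE mulr_suml.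
  by apply: eq_bigr => l _; ring.
rewrite (_ : (fun s => _) = (fun s =>
    \sum_j \sum_l (C i l * G j k) * expm (s *: A) l j)); last first.
  by apply/funext => r; rewrite E.
rewrite -(mulmxA C) E.
rewrite (_ : \sum_j _ = \sum_j \sum_l ((C i l * G j k) * (expm (s *: A) *m A) l j +
    expm (s *: A) l j * 0)); last first.
  by apply: eq_bigr => j _; apply: eq_bigr => l _; rewrite mulr0 addr0.
apply: (is_derive_sum1 (df := fun j s => \sum_l ((C i l * G j k) *
  (expm (s *: A) *m A) l j + expm (s *: A) l j * 0))) => j.
apply: (is_derive_sum1 (df := fun l s => (C i l * G j k) *
  (expm (s *: A) *m A) l j + expm (s *: A) l j * 0)) => l.
exact: is_deriveM1 (is_derive_cst1 _ _) (is_derive_expm A s l j).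
Qed.

Lemma continuous_impulse i k : continuous (fun s : R => (C *m expm (s *: A) *m G) i k).
Proof. by move=> s; exact: is_derive_cont (is_derive_impulse i k s). Qed.

End impulse_response.

Section output_bound.
Context d (Omega : measurableType d) (R : realType) (P : probability Omega R).
Context (m1 m2 p : nat) (F : R -> set (set Omega)).
Variables (u : R -> Omega -> 'cV[R]_m1) (M : R -> Omega -> 'cV[R]_m2) (K S : 'M[R]_m2).
Hypotheses (hF : filtration_usual P F) (hsq : square_integrable P M)
  (hmean : mean_zero P M) (had : adapted F M)
  (hind : increments_independent_of_past P F M)
  (hcov : covariance_matrix P M K) (hS : psd_sqrt K S).
Variables (t T : R).
Hypotheses (t0 : 0 < t) (tT : t <= T) (ju : jointly_measurable u)
  (uT : (control_norm P T u < +oo)%E).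
Notation mu := (@lebesgue_measure R).

Let mu2 : @measurable_fun _ _ (measurableTypeR R * Omega)%type R
  (`[0, T] `*` setT) (fun z => enorm (u z.1 z.2) ^+ 2).
Proof.
rewrite (_ : (fun z => _) = (fun z : measurableTypeR R * Omega =>
    \sum_i u z.1 z.2 i 0 ^+ 2)); last first.
  by apply/funext => z; rewrite enorm_sqr.
by apply: measurable_sum => i; apply: measurable_funX; exact: joint_coord.
Qed.

Let emu2 : @measurable_fun _ _ (measurableTypeR R * Omega)%type _
  (`[0, T] `*` setT) (fun z => (enorm (u z.1 z.2) ^+ 2)%:E).
Proof. by apply/measurable_EFinP; exact: mu2. Qed.

Let u2_ge0 (z : R * Omega) : (0 <= (enorm (u z.1 z.2) ^+ 2)%R%:E)%E.
Proof. by rewrite lee_fin sqr_ge0. Qed.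

Let B w : \bar R := (\int[mu]_(s in `[0%R, T]) (enorm (u s w) ^+ 2)%R%:E)%E.

Let B_ge0 w : (0 <= B w)%E.
Proof. by apply: integral_ge0 => s _; rewrite lee_fin sqr_ge0. Qed.

Let mB : measurable_fun setT B.
Proof.
exact: (measurable_integral_on mu (measurable_itv `[0, T]) measurableT emu2 u2_ge0).
Qed.

Let energy_fin : (\int[P]_w B w < +oo)%E.
Proof.
have e0 : (0 <= \int[P]_w B w)%E by exact: integral_ge0.
rewrite ltey; apply/eqP => eoo; move: uT.
by rewrite /control_norm -/(B _) eoo /sqrte ltxx.
Qed.

Lemma control_ae_sqintegrable : {ae P, forall w,
  mu.-integrable `[0, T] (fun s => (enorm (u s w) ^+ 2)%:E)}.
Proof.
have fin : (\int[mu]_(s in `[0%R, T]) \int[P]_(w in setT)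
    `|enorm (u s w) ^+ 2|%R%:E < +oo)%E.
  under eq_integral do under eq_integral do rewrite ger0_norm ?sqr_ge0//.
  by rewrite (tonelli_on mu P (measurable_itv `[0, T]) measurableT emu2 u2_ge0).
have := @ae_integrable_on _ _ (measurableTypeR R) Omega R mu P _ _
  (measurable_itv `[0, T]) measurableT _ mu2 fin.
by apply: filterS => w; apply.
Qed.

Lemma control_ae_integrable : {ae P, forall w, forall k,
  mu.-integrable `[0, t] (fun s => (u s w k 0)%:E)}.
Proof.
apply: filterS control_ae_sqintegrable => w ui k.
have mk : measurable_fun (`[0, t] : set (measurableTypeR R)) (fun s => u s w k 0).
  by have := measurable_section2 (measurable_itv `[0, t]) measurableT
    (I : setT w) (joint_coord (t := t) k ju); exact.
apply: (@le_integrable _ (measurableTypeR R) R mu _ (measurable_itv _) _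
    (fun s => (1 + enorm (u s w) ^+ 2)%:E)).
- by apply/measurable_EFinP; exact: mk.
- move=> s _ /=; rewrite lee_fin [leRHS]ger0_norm ?addr_ge0 ?sqr_ge0//.
  have := normM_le_sqr 1 (u s w k 0); rewrite mul1r expr1n => /le_trans; apply.
  by rewrite lerD2l enorm_sqr (bigD1 k)//= lerDl sumr_ge0// => j _; exact: sqr_ge0.
- rewrite (_ : (fun s => _) = (EFin \o cst 1%R) \+ (fun s => (enorm (u s w) ^+ 2)%R%:E))%E//.
  apply: integrableD => //.
    by apply: integrable_cont => s _; exact: cvg_cst.
  apply: (integrableS _ _ _ ui) => //.
  by apply: subset_itvl; rewrite bnd_simp.
Qed.

Variables (Y : Omega -> 'cV[R]_p).
Variables (Hu : R -> 'M[R]_(p, m1)) (H dH : R -> 'M[R]_(p, m2)).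
Hypotheses (mY : forall i, measurable_fun setT (fun w => Y w i 0))
  (cHu : forall i k, continuous (fun s => Hu s i k))
  (HdH : forall i k (s : R), is_derive s 1 (fun s => H s i k) (dH s i k))
  (cdH : forall i k, continuous (fun s => dH s i k))
  (mild : forall i, mild_output P u M t (fun s => row i (Hu s))
     (fun s => row i (H s)) (fun s => row i (dH s)) (fun w => Y w i 0)).

(** The constants l1 and l2 of [norm_bound] stay free until the expectation has
    been taken, so each side is integrated once; optimising l1 gives the noise
    term and optimising l2 the control term. *)
Lemma output_bound :
  (\int[P]_w (enorm (Y w))%:E <=
   (Num.sqrt (\int[mu]_(s in `[0%R, t]) frobenius (Hu s) ^+ 2))%R%:E * control_norm P T u +
   (Num.sqrt (\int[mu]_(s in `[0%R, t]) frobenius (H s *m S) ^+ 2))%R%:E)%E.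
Proof.
have [g Hg] := choice mild.
pose V w i := \int[mu]_(s in `[0, t]) g i (s, w).
have mV i : measurable_fun setT (fun w => V w i).
  have [mg _ _] := Hg i.
  exact: (measurable_Rintegral_on mu (measurable_itv `[0, t]) measurableT mg).
have rowE q (Q : R -> 'M[R]_(p, q)) i k : (fun s => row i (Q s) 0 k) = (fun s => Q s i k).
  by apply/funext => s; rewrite mxE.
have dH' i k (s : R) : is_derive s 1 (fun s => row i (H s) 0 k) (row i (dH s) 0 k).
  by rewrite rowE mxE; exact: HdH.
have cdH' i k : continuous (fun s => row i (dH s) 0 k).
  by rewrite rowE; exact: cdH.
have varV i := noise_variance hF hsq hmean had hind hcov hS t0 (dH' i) (cdH' i)
  (let: And3 mg _ _ := Hg i in mg) (let: And3 _ e _ := Hg i in e).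
have cHS i l : continuous (fun s => (row i (H s) *m S) 0 l).
  move=> s; under eq_fun do rewrite mxE.
  apply: cvg_big => [|k _]; first exact: add_continuous.
  by apply: cvgM; [exact: is_derive_cont (dH' i k s)|exact: cvg_cst].
pose v := \int[mu]_(s in `[0, t]) frobenius (H s *m S) ^+ 2.
have vE : v = \sum_i \int[mu]_(s in `[0, t]) \sum_l (row i (H s) *m S) 0 l ^+ 2.
  have is2 i : mu.-integrable `[0, t]
      (EFin \o (fun s => \sum_l (row i (H s) *m S) 0 l ^+ 2)).
    apply: integrable_cont => s _; apply: cvg_big => [|l _]; first exact: add_continuous.
    by apply: cvgM; exact: cHS.
  have [_ <-] := @Rintegral_sum R _ (measurableTypeR R) mu _ _ _ (measurable_itv `[0, t]) is2.
  apply: eq_Rintegral => s _; rewrite frobenius_sqr; apply: eq_bigr => i _.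
  by apply: eq_bigr => l _; rewrite -row_mul [in RHS]mxE.
have v0 : 0 <= v by apply: Rintegral_ge0 => s _; exact: sqr_ge0.
have EV : (\int[P]_w (\sum_i V w i ^+ 2)%R%:E = v%:E)%E.
  under eq_integral do rewrite -sumEFin.
  rewrite ge0_integral_sum//.
  - by rewrite vE -sumEFin; apply: eq_bigr => i _; exact: varV.
  - by move=> i; apply/measurable_EFinP; exact: measurable_funX.
  - by move=> i w _; rewrite lee_fin sqr_ge0.
pose al := \int[mu]_(s in `[0, t]) frobenius (Hu s) ^+ 2.
have al0 : 0 <= al by apply: Rintegral_ge0 => s _; exact: sqr_ge0.
have alE : \int[mu]_(s in `[0, t]) frobenius (Hu (t - s)) ^+ 2 = al.
  apply: (@Rintegral_reflect R (fun s => frobenius (Hu s) ^+ 2) t (ltW t0)).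
  rewrite (_ : (fun s => _) = (fun s => \sum_i \sum_k Hu s i k ^+ 2)); last first.
    by apply/funext => s; rewrite frobenius_sqr.
  move=> s; apply: cvg_big => [|i _]; first exact: add_continuous.
  apply: cvg_big => [|k _]; first exact: add_continuous.
  by apply: cvgM; exact: cHu.
have [j j0 jE] : exists2 j : R, 0 <= j & (\int[P]_w B w = j%:E)%E.
  exists (fine (\int[P]_w B w)%E); first by rewrite fine_ge0// integral_ge0.
  by rewrite fineK// ge0_fin_numE// integral_ge0.
have V2_ge0 w : 0 <= \sum_i V w i ^+ 2 by apply: sumr_ge0 => i _; exact: sqr_ge0.
have main l1 l2 : 0 < l1 -> 0 < l2 -> (\int[P]_w (enorm (Y w))%:E <=
    (l1 / 2 * 1 + (2 * l1)^-1 * v + (l2 / 2 * al + (2 * l2)^-1 * j))%R%:E)%E.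
  move=> l10 l20.
  have i2l (l : R) : 0 < l -> 0 <= (2 * l)^-1 by move=> l0'; rewrite invr_ge0 mulr_ge0// ltW.
  have V2_ge0' w : 0 <= (2 * l1)^-1 * (\sum_i V w i ^+ 2) by rewrite mulr_ge0 ?i2l.
  pose c := l1 / 2 + l2 / 2 * al.
  have c0 : 0 <= c.
    by rewrite addr_ge0// ?mulr_ge0// ?divr_ge0// ?(ltW l10) ?(ltW l20).
  have mV2 : measurable_fun setT (fun w => ((2 * l1)^-1 * (\sum_i V w i ^+ 2))%:E).
    apply/measurable_EFinP; apply: measurable_funM => //.
    by apply: measurable_sum => i; exact: measurable_funX.
  apply: (@le_trans _ _ (\int[P]_w (c%:E + ((2 * l1)^-1 * (\sum_i V w i ^+ 2))%R%:E +
      ((2 * l2)^-1)%R%:E * B w))%E).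
    apply: ae_ge0_le_integral => //.
    - by move=> w _; rewrite lee_fin sqrtr_ge0.
    - apply/measurable_EFinP; apply: (@measurableT_comp _ _ _ _ _ _ (@Num.sqrt R)) => //.
        by apply: continuous_measurable_fun; exact: sqrt_continuous.
      by apply: measurable_sum => i; apply: measurable_funX; exact: mY.
    - move=> w _; apply: adde_ge0; last by rewrite mule_ge0// lee_fin i2l.
      by rewrite -EFinD lee_fin addr_ge0.
    - apply: emeasurable_funD; last exact: emeasurable_funM.
      exact: emeasurable_funD.
    - have aeg : {ae P, forall w, forall i,
          [/\ mu.-integrable `[0, t] (fun s => (g i (s, w))%:E),
            mu.-integrable `[0, t] (fun s => ((row i (Hu (t - s)) *m u s w) 0 0)%:E) &
            Y w i 0 = \int[mu]_(s in `[0, t]) g i (s, w) +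
                  \int[mu]_(s in `[0, t]) (row i (Hu (t - s)) *m u s w) 0 0]}.
        by apply: filter_forall => i; have [] := Hg i.
      apply: filterS2 aeg control_ae_sqintegrable => w gw uw _.
      have rE s i : (row i (Hu (t - s)) *m u s w) 0 0 = (Hu (t - s) *m u s w) i 0.
        by rewrite -row_mul [LHS]mxE.
      have uwt : mu.-integrable `[0, t] (fun s => (enorm (u s w) ^+ 2)%:E).
        apply: (integrableS _ _ _ uw) => //.
        by apply: subset_itvl; rewrite bnd_simp.
      have Hi i : mu.-integrable `[0, t] (fun s => ((Hu (t - s) *m u s w) i 0)%:E).
        have [_ + _] := gw i; congr (_.-integrable _ _).
        by apply/funext => s; rewrite rE.
      have YE i : Y w i 0 = (\col_i V w i) i 0 +
          \int[mu]_(s in `[0, t]) (Hu (t - s) *m u s w) i 0.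
        have [_ _ ->] := gw i; rewrite mxE; congr (_ + _).
        by apply: eq_Rintegral => s _; rewrite rE.
      have := norm_bound l10 l20 cHu uwt Hi YE; rewrite alE -lee_fin => /le_trans; apply.
      under eq_bigr do rewrite mxE.
      rewrite [leLHS](_ : _ = (c%:E + ((2 * l1)^-1 * (\sum_i V w i ^+ 2))%R%:E +
          ((2 * l2)^-1 * \int[mu]_(s in `[0%R, t]) enorm (u s w) ^+ 2)%R%:E)%E); last first.
        by rewrite -!EFinD; congr EFin; rewrite /c; ring.
      rewrite leeD2l// EFinM lee_wpmul2l ?lee_fin ?i2l//.
      rewrite EFin_Rintegral//; apply: ge0_subset_integral => //.
      + by have /integrableP[] := uw.
      + by move=> s _; rewrite lee_fin sqr_ge0.
      + by apply: subset_itvl; rewrite bnd_simp.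
  rewrite ge0_integralD//; last 4 first.
  - by move=> w _; rewrite -EFinD lee_fin addr_ge0.
  - exact: emeasurable_funD.
  - by move=> w _; rewrite mule_ge0// lee_fin i2l.
  - exact: emeasurable_funM.
  rewrite ge0_integralD//; last first.
    by move=> w _; rewrite lee_fin.
  have Pc : (\int[P]_w c%:E = c%:E)%E.
    by rewrite integral_cst// -[RHS]mule1; congr (_ * _)%E; exact: probability_setT.
  rewrite Pc ge0_integralZl ?lee_fin ?i2l// jE.
  under [X in (_ + X + _)%E]eq_integral do rewrite EFinM.
  rewrite ge0_integralZl ?lee_fin ?i2l//; last 2 first.
  - by apply/measurable_EFinP; apply: measurable_sum => i; exact: measurable_funX.
  - by move=> w _; rewrite lee_fin.
  rewrite EV -!EFinM -!EFinD lee_fin le_eqVlt; apply/orP; left; apply/eqP.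
  by rewrite /c; ring.
have Ynn : (0 <= \int[P]_w (enorm (Y w))%:E)%E.
  by apply: integral_ge0 => w _; rewrite lee_fin sqrtr_ge0.
have Yfin : (\int[P]_w (enorm (Y w))%:E \is a fin_num)%E.
  by rewrite ge0_fin_numE// (le_lt_trans (main 1 1 ltr01 ltr01))// ltry.
rewrite /control_norm -/(B _) jE /sqrte -EFinM -EFinD -(fineK Yfin) lee_fin.
set r := fine _.
have main' l1 l2 : 0 < l1 -> 0 < l2 ->
    r <= l1 / 2 * 1 + (2 * l1)^-1 * v + (l2 / 2 * al + (2 * l2)^-1 * j).
  by move=> l10 l20; rewrite -lee_fin (fineK Yfin); exact: main.
apply: le_sqrt_of_amgm => // l2 l20.
have : r <= Num.sqrt 1 * Num.sqrt v + (l2 / 2 * al + (2 * l2)^-1 * j).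
  by apply: le_sqrt_of_amgm => // l1 l10; exact: main'.
by rewrite sqrtr1 mul1r [Num.sqrt v + _]addrC.
Qed.

End output_bound.

(** * The error bound *)

Lemma L2norm_ge (R : realType) m n (Y : R -> 'M[R]_(m, n)) (W : 'M[R]_n) (t : R) :
  0 <= t -> (forall i k, continuous (fun s => Y s i k)) ->
  ((Num.sqrt (\int[lebesgue_measure]_(s in `[0%R, t]) frobenius (Y s *m W) ^+ 2))%R%:E
    <= L2norm Y W)%E.
Proof.
move=> t0 cY.
have cf : continuous (fun s => frobenius (Y s *m W) ^+ 2).
  rewrite (_ : (fun s => _) = (fun s => \sum_i \sum_k (\sum_j Y s i j * W j k) ^+ 2)).
    move=> s; apply: cvg_big => [|i _]; first exact: add_continuous.
    apply: cvg_big => [|k _]; first exact: add_continuous.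
    have c1 : (\sum_j Y x i j * W j k) @[x --> s] --> \sum_j Y s i j * W j k.
      apply: cvg_big => [|j _]; first exact: add_continuous.
      by apply: cvgM; [exact: cY|exact: cvg_cst].
    by apply: cvgM.
  apply/funext => s; rewrite frobenius_sqr; apply: eq_bigr => i _.
  by apply: eq_bigr => k _; rewrite mxE.
have fi : lebesgue_measure.-integrable `[0, t] (EFin \o (fun s => frobenius (Y s *m W) ^+ 2)).
  by apply: integrable_cont => s _; exact: cf.
rewrite (_ : (Num.sqrt _)%:E = sqrte (\int[lebesgue_measure]_(s in `[0%R, t])
  (frobenius (Y s *m W) ^+ 2)%R%:E)%E); last by rewrite -EFin_Rintegral.
rewrite lee_sqrt; last by apply: integral_ge0 => s _; rewrite lee_fin sqr_ge0.
apply: ge0_subset_integral => //.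
- apply/measurable_EFinP; apply: measurable_funTS; exact: continuous_measurable_fun.
- by move=> s _; rewrite lee_fin sqr_ge0.
- by apply: subset_itvl; rewrite bnd_simp.
Qed.

Theorem mainTheorem4 (R : realType)
  (d : measure_display) (Omega : measurableType d) (P : probability Omega R)
  (F : R -> set (set Omega)) (hF : filtration_usual P F)
  (n m1 m2 p r1 r2 : nat)
  (A : 'M[R]_n) (B1 : 'M[R]_(n, m1)) (B2 : 'M[R]_(n, m2)) (C : 'M[R]_(p, n))
  (Ah1 : 'M[R]_r1) (Bh1 : 'M[R]_(r1, m1)) (Ch1 : 'M[R]_(p, r1))
  (Ah2 : 'M[R]_r2) (Bh2 : 'M[R]_(r2, m2)) (Ch2 : 'M[R]_(p, r2))
  (M : R -> Omega -> 'cV[R]_m2) (K sqrtK : 'M[R]_m2)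
  (hM_levy : levy_process P M)
  (hM_sqint : square_integrable P M)
  (hM_mean : mean_zero P M)
  (hM_adapted : adapted F M)
  (hM_indep : increments_independent_of_past P F M)
  (hM_cov : covariance_matrix P M K)
  (hsqrtK : psd_sqrt K sqrtK)
  (u : R -> Omega -> 'cV[R]_m1)
  (hu_adapted : adapted F u)
  (hu_meas : jointly_measurable u)
  (hu_L2 : forall T : R, 0 < T -> (control_norm P T u < +oo)%E)
  (x : R -> Omega -> 'cV[R]_n)
  (xh1 : R -> Omega -> 'cV[R]_r1) (xh2 : R -> Omega -> 'cV[R]_r2)
  (hx : solves_sde P F A B1 B2 u M x)
  (hxh1 : solves_sde P F Ah1 Bh1 (0 : 'M[R]_(r1, m2)) u M xh1)
  (hxh2 : solves_sde P F Ah2 (0 : 'M[R]_(r2, m1)) Bh2 u M xh2)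
  (y yh : R -> Omega -> 'cV[R]_p)
  (hy : forall (t : R) (w : Omega), 0 <= t -> y t w = C *m x t w)
  (hyh : forall (t : R) (w : Omega), 0 <= t -> yh t w = Ch1 *m xh1 t w + Ch2 *m xh2 t w)
  (hA : stable A) (hAh1 : stable Ah1) (hAh2 : stable Ah2) :
  forall T : R, 0 < T ->
  (ereal_sup [set 'E_P[fun w => enorm (y t w - yh t w)%R] | t in `[0%R, T]]
   <= L2norm (fun s => C *m expm (s *: A) *m B1
                       - Ch1 *m expm (s *: Ah1) *m Bh1)%R 1%:M
        * control_norm P T u
      + L2norm (fun s => C *m expm (s *: A) *m B2
                         - Ch2 *m expm (s *: Ah2) *m Bh2)%R sqrtK)%E.
Proof.
move=> T T0.
have L0 a b (Z : R -> 'M[R]_(a, b)) W : (0 <= L2norm Z W)%E by exact: sqrte_ge0.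
have c0 : (0 <= control_norm P T u)%E by exact: sqrte_ge0.
apply: ge_ereal_sup => _ [t + <-]; rewrite /= in_itv/= => /andP[t0 tT]; rewrite unlock.
have yE i w (s : R) : 0 <= s -> (y s w - yh s w) i 0 =
    (row i C *m x s w) 0 0 - (row i Ch1 *m xh1 s w) 0 0 - (row i Ch2 *m xh2 s w) 0 0.
  move=> s0; rewrite hy// hyh//.
  have rE q (Q : 'M[R]_(p, q)) (v : 'cV[R]_q) : (row i Q *m v) 0 0 = (Q *m v) i 0.
    by rewrite -row_mul [LHS]mxE.
  rewrite !rE.
  by move: (C *m _) (Ch1 *m _) (Ch2 *m _) => a b c; rewrite !mxE; ring.
have mY s i : 0 <= s -> measurable_fun setT (fun w => (y s w - yh s w) i 0).
  move=> s0; rewrite (_ : (fun w => _) = (fun w =>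
     \sum_k C i k * x s w k 0 - (\sum_k Ch1 i k * xh1 s w k 0 +
     \sum_k Ch2 i k * xh2 s w k 0))).
    have mX n' (X : R -> Omega -> 'cV[R]_n') (Q : 'M[R]_(p, n')) : adapted F X ->
        measurable_fun setT (fun w => \sum_k Q i k * X s w k 0).
      move=> aX; apply: measurable_sum => k; apply: measurable_funM => //.
      exact: (adapted_coord_measurable hF k aX s0).
    apply: measurable_funB; first exact: mX (sde_adapted hx).
    by apply: measurable_funD; [exact: mX (sde_adapted hxh1)|exact: mX (sde_adapted hxh2)].
  by apply/funext => w; rewrite hy// hyh// !mxE.
(* At time 0 all states vanish almost surely. *)
move: t0; rewrite le_eqVlt => /predU1P[t0|t0].
  rewrite -t0 (_ : integral _ _ _ = 0%E); first by rewrite adde_ge0// mule_ge0.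
  rewrite (ae_eq_integral (fun=> 0%E))//; first by rewrite integral0.
  - apply/measurable_EFinP; apply: (@measurableT_comp _ _ _ _ _ _ (@Num.sqrt R)) => //.
      by apply: continuous_measurable_fun; exact: sqrt_continuous.
    by apply: measurable_sum => i; apply: measurable_funX; exact: mY.
  - apply: filterS2 (sde_initial hx)
      (filterI (sde_initial hxh1) (sde_initial hxh2)) => w /= x0 [h1 h2] _.
    rewrite hy// hyh// x0 h1 h2 !mulmx0 addr0 subr0 /enorm big1 ?sqrtr0// => i _.
    by rewrite mxE expr0n.
have tn := ltW t0.
pose Hu s := C *m expm (s *: A) *m B1 - Ch1 *m expm (s *: Ah1) *m Bh1.
pose H s := C *m expm (s *: A) *m B2 - Ch2 *m expm (s *: Ah2) *m Bh2.
pose dH s := C *m expm (s *: A) *m A *m B2 - Ch2 *m expm (s *: Ah2) *m Ah2 *m Bh2.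
have subE q (X Z : R -> 'M[R]_(p, q)) i k :
    (fun s => (X s - Z s) i k) = (fun s => X s i k - Z s i k).
  by apply/funext => s; rewrite [LHS]mxE [X in _ + X]mxE.
have cHu i k : continuous (fun s => Hu s i k).
  rewrite subE => s; apply: cvgB; exact: continuous_impulse.
have HdH i k (s : R) : is_derive s 1 (fun s => H s i k) (dH s i k).
  rewrite subE (_ : dH s i k = (C *m expm (s *: A) *m A *m B2) i k -
    (Ch2 *m expm (s *: Ah2) *m Ah2 *m Bh2) i k).
    exact: is_deriveB1 (is_derive_impulse _ _ _ _ _ _) (is_derive_impulse _ _ _ _ _ _).
  exact: (congr1 (@^~ s) (subE _ (fun s => C *m expm (s *: A) *m A *m B2)
    (fun s => Ch2 *m expm (s *: Ah2) *m Ah2 *m Bh2) i k)).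
have cdH i k : continuous (fun s => dH s i k).
  rewrite subE => s.
  by apply: cvgB; rewrite -mulmxA; under eq_fun do rewrite -mulmxA;
    exact: continuous_impulse.
have ui := control_ae_integrable tT hu_meas (hu_L2 T T0).
(* Row by row, the error is the full output minus the two reduced outputs;
   the first reduced subsystem has no noise and the second no control. *)
have mild i : mild_output P u M t (fun s => row i (Hu s)) (fun s => row i (H s))
    (fun s => row i (dH s)) (fun w => (y t w - yh t w) i 0).
  have := mild_outputB (mild_outputB
     (mild_output_sde (row i C) t0 hx hu_meas ui)
     (mild_output_sde (row i Ch1) t0 hxh1 hu_meas ui))
     (mild_output_sde (row i Ch2) t0 hxh2 hu_meas ui).
  congr mild_output.
  - by apply/funext => s; rewrite /Hu linearB/= !row_mul mulmx0 subr0.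
  - by apply/funext => s; rewrite /H linearB/= !row_mul mulmx0 subr0.
  - by apply/funext => s; rewrite /dH linearB/= !row_mul mulmx0 subr0.
  - by apply/funext => w; rewrite yE.
apply: (le_trans (output_bound hF hM_sqint hM_mean hM_adapted hM_indep hM_cov hsqrtK
  t0 tT hu_meas (hu_L2 T T0) (fun i => mY t i tn) cHu HdH cdH mild)).
apply: leeD; last first.
  apply: (L2norm_ge _ tn) => i k s; exact: is_derive_cont (HdH i k s).
apply: lee_wpmul2r => //.
have := @L2norm_ge R _ _ Hu 1%:M t tn cHu.
by under eq_Rintegral do rewrite mulmx1.
Qed.
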